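(* Let $\Gamma$ and $\Lambda$ be finitely generated groups. The following are equivalent: (1) With any choice of word metrics, $\Gamma$ and $\Lambda$ are bi-Lipschitz equivalent. (2) The $\mathrm{C}^*$-algebras $\ell_\infty(\Gamma)\rtimes_r\Gamma$ and $\ell_\infty(\Lambda)\rtimes_r\Lambda$ are $*$-isomorphic.
   Context: Metric spaces $(X,d_X)$ and $(Y,d_Y)$ are bi-Lipschitz equivalent if there is a bijection $f\colon X\to Y$ such that $f$ and $f^{-1}$ are Lipschitz. For a discrete group $\Gamma$, $\ell_\infty(\Gamma)\rtimes_r\Gamma$ denotes the reduced crossed product $\mathrm{C}^*$-algebra for the action of $\Gamma$ on $\ell_\infty(\Gamma)$ (bounded complex-valued functions on $\Gamma$, equivalently $C(\beta\Gamma)$ with $\beta\Gamma$ the Čech–Stone compactification) induced by translation. A word metric is the metric associated to a finite generating set. *)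

(* Defs.v *)
From HB Require Import structures.
From mathcomp Require Import all_boot all_order all_algebra finmap complex.
From mathcomp Require Import all_classical all_reals all_analysis.
From mathcomp Require summability.
From mathcomp Require Import ring.

Set Implicit Arguments.
Unset Strict Implicit.
Unset Printing Implicit Defensive.

Import Order.TTheory GRing.Theory Num.Theory.
Import numFieldNormedType.Exports.
Import ComplexField.Normc.

Local Open Scope classical_set_scope.
Local Open Scope ring_scope.

Section Words.
Variable G : groupType.
Implicit Types (S : {fset G}) (w : seq G) (g h k : G).

Definition is_word S w : bool := all (fun x => (x \in S) || (x^-1%g \in S)) w.

Definition word_val w : G := (\prod_(x <- w) x)%g.

Definition generates S : Prop := forall g, exists2 w, is_word S w & word_val w = g.

Record genset := Genset { gens :> {fset G}; gensP : generates gens }.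

Definition word_of_length S g (n : nat) : bool :=
  `[< exists w, [/\ is_word S w, word_val w = g & size w = n] >].

Lemma word_of_length_ex (S : genset) g : exists n, word_of_length S g n.
Proof.
by have [w Sw <-] := gensP S g; exists (size w); apply/asboolP; exists w.
Qed.

Definition word_length (S : genset) g : nat := ex_minn (word_of_length_ex S g).

Lemma word_lengthP (S : genset) g :
  exists w, [/\ is_word S w, word_val w = g & size w = word_length S g].
Proof. by rewrite /word_length; case: ex_minnP => n /asboolP. Qed.

Lemma word_length_min (S : genset) w :
  is_word S w -> (word_length S (word_val w) <= size w)%N.
Proof.
move=> Sw; rewrite /word_length; case: ex_minnP => n _; apply.
by apply/asboolP; exists w.
Qed.

Lemma word_length1 (S : genset) : word_length S 1%g = 0%N.
Proof.
apply/eqP; rewrite -leqn0.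
by have := @word_length_min S [::] isT; rewrite /word_val big_nil.
Qed.

Lemma word_length_eq0 (S : genset) g : word_length S g = 0%N -> g = 1%g.
Proof.
have [w [_ <- <-]] := word_lengthP S g; case: w => // _.
by rewrite /word_val big_nil.
Qed.

Lemma word_val_inv w : word_val (rev (map (fun x => x^-1%g) w)) = (word_val w)^-1%g.
Proof.
elim: w => [|x w IHw]; first by rewrite /word_val !big_nil invg1.
rewrite /= rev_cons -cats1 /word_val big_cat /= -/(word_val _) IHw.
by rewrite /word_val big_cons big_nil mulg1 big_cons invgM.
Qed.

Lemma word_lengthV (S : genset) g : word_length S g^-1%g = word_length S g.
Proof.
have le h : (word_length S h^-1%g <= word_length S h)%N.
  have [w [Sw <- <-]] := word_lengthP S h.
  have -> : size w = size (rev (map (fun x => x^-1%g) w)).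
    by rewrite size_rev size_map.
  rewrite -word_val_inv; apply: word_length_min.
  rewrite /is_word all_rev all_map; apply: sub_all Sw => x /=.
  by rewrite invgK orbC.
by apply/eqP; rewrite eqn_leq le /= -{1}[g]invgK le.
Qed.

Lemma word_lengthM (S : genset) g h :
  (word_length S (g * h)%g <= word_length S g + word_length S h)%N.
Proof.
have [v [Sv <- <-]] := word_lengthP S g; have [w [Sw <- <-]] := word_lengthP S h.
rewrite -size_cat /word_val -big_cat; apply: word_length_min.
by rewrite /is_word all_cat; apply/andP.
Qed.

Definition finitely_generated : Prop := exists S : {fset G}, generates S.

End Words.

(* R is a phantom parameter: it fixes the type of distances in the metricType instance. *)
Definition word_space (R : realType) (G : groupType) (S : genset G) : Type := G.

Section WordMetric.
Variables (R : realType) (G : groupType) (S : genset G).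
Implicit Types x y z : word_space R S.

HB.instance Definition _ := Choice.copy (word_space R S) G.

Definition word_dist x y : R := (word_length S ((x : G)^-1 * (y : G))%g)%:R.

Fact word_distxx x : word_dist x x = 0.
Proof. by rewrite /word_dist mulVg word_length1. Qed.

Fact word_dist_positivity x y : word_dist x y = 0 -> x = y.
Proof.
move=> /eqP; rewrite pnatr_eq0 => /eqP /word_length_eq0 /(congr1 (fun z => (x : G) * z)%g).
by rewrite mulVKg mulg1.
Qed.

Fact word_dist_sym x y : word_dist x y = word_dist y x.
Proof. by rewrite /word_dist -word_lengthV invgM invgK. Qed.

Fact word_dist_triangle y x z : word_dist x z <= word_dist x y + word_dist y z.
Proof.
rewrite /word_dist -natrD ler_nat; apply: leq_trans (word_lengthM _ _ _).
by rewrite -mulgA mulVKg.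
Qed.

HB.instance Definition _ := isMetric.Build R (word_space R S)
  word_distxx word_dist_positivity word_dist_sym word_dist_triangle.

End WordMetric.

Definition lipschitz_map (R : realType) (X Y : metricType R) (f : X -> Y) : Prop :=
  exists L : R, forall x y, mdist (f x) (f y) <= L * mdist x y.

Definition bi_lipschitz_equivalent (R : realType) (X Y : metricType R) : Prop :=
  exists (f : X -> Y) (f' : Y -> X),
    [/\ cancel f f', cancel f' f, lipschitz_map f & lipschitz_map f'].

Section SquareSum.
Variables (R : realType) (I : choiceType).
Implicit Types (x y : I -> R[i]).

Definition sqsum x : \bar R := \esum_(i in [set: I]) (normc (x i) ^+ 2)%:E.

Lemma sqsum_ge0 x : (0 <= sqsum x)%E.
Proof. by apply: esum_ge0 => i _; rewrite lee_fin sqr_ge0. Qed.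

Lemma sqsum_le_scale (k : R) x y : 0 <= k ->
  (forall i, normc (y i) ^+ 2 <= k * normc (x i) ^+ 2) ->
  (sqsum y <= k%:E * sqsum x)%E.
Proof.
move=> k0 le_yx; apply: ge_ereal_sup => _ [A [finA _] <-].
apply: (@le_trans _ _ (\sum_(i \in A) k%:E * (normc (x i) ^+ 2)%:E)%E).
  by apply: lee_fsum => // i _; rewrite -EFinM lee_fin.
rewrite -ge0_mule_fsumr; last by move=> i; rewrite lee_fin sqr_ge0.
apply: lee_wpmul2l; first by rewrite lee_fin.
by apply: ereal_sup_ubound; exists A.
Qed.

Lemma sqsumD_le (a b : R) x y : 0 < a -> 0 < b ->
  (sqsum (x + y)%R <= ((a + b) / a)%:E * sqsum x + ((a + b) / b)%:E * sqsum y)%E.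
Proof.
move=> a0 b0; have ab0 : 0 < a + b by rewrite addr_gt0.
apply: ge_ereal_sup => _ [A [finA _] <-].
apply: (@le_trans _ _ (\sum_(i \in A)
  (((a + b) / a)%:E * (normc (x i) ^+ 2)%:E +
   ((a + b) / b)%:E * (normc (y i) ^+ 2)%:E))%E).
  apply: lee_fsum => // i _; rewrite -!EFinM -EFinD lee_fin.
  have h : normc (x i + y i) <= normc (x i) + normc (y i) by exact: le_normcD.
  have n0 z : 0 <= normc (z : R[i]) by case: z => ? ?; exact: sqrtr_ge0.
  apply: (@le_trans _ _ ((normc (x i) + normc (y i)) ^+ 2)).
    by rewrite ler_sqr // nnegrE ?addr_ge0.
  set p := normc (x i); set q := normc (y i).
  rewrite -subr_ge0.
  have -> : (a + b) / a * p ^+ 2 + (a + b) / b * q ^+ 2 - (p + q) ^+ 2 =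
            (b * p - a * q) ^+ 2 / (a * b).
    by field; rewrite !gt_eqF.
  by rewrite divr_ge0 ?sqr_ge0 // ltW // mulr_gt0.
rewrite fsbig_split //= leeD //.
  rewrite -ge0_mule_fsumr; last by move=> i; rewrite lee_fin sqr_ge0.
  apply: lee_wpmul2l; first by rewrite lee_fin divr_ge0 ?ltW.
  by apply: ereal_sup_ubound; exists A.
rewrite -ge0_mule_fsumr; last by move=> i; rewrite lee_fin sqr_ge0.
apply: lee_wpmul2l; first by rewrite lee_fin divr_ge0 ?ltW.
by apply: ereal_sup_ubound; exists A.
Qed.

Lemma sqsum_ge_term x i : ((normc (x i) ^+ 2)%:E <= sqsum x)%E.
Proof.
apply: esum_ge; exists [set i]; first by split.
by rewrite fsbig_set1.
Qed.

Lemma sqsum_eq0 x : sqsum x = 0%E -> x = 0.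
Proof.
move=> x0; apply/funext => i; apply: eq0_normc; apply/eqP.
rewrite -sqrf_eq0 eq_le sqr_ge0 andbT -lee_fin.
by have := sqsum_ge_term x i; rewrite x0.
Qed.

Lemma sqsum0 : sqsum 0 = 0%E.
Proof. by apply: esum1 => i _; rewrite -[normc _]/(normc (0 : R[i])) normc0 expr0n. Qed.

Lemma sqsum_reindex (p q : I -> I) x : cancel p q -> cancel q p ->
  sqsum (x \o p) = sqsum x.
Proof.
move=> pK qK; rewrite /sqsum [RHS](reindex_esum setT setT p) //.
by rewrite setTT_bijective; exists q.
Qed.

Lemma sqsumZ_le (c : R[i]) x : (sqsum (c *: x)%R <= (normc c ^+ 2)%:E * sqsum x)%E.
Proof.
apply: sqsum_le_scale; first exact: sqr_ge0.
by move=> i; rewrite -exprMn -normcM.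
Qed.

Definition l2_pred : {pred I -> R[i]} := fun x => `[< (sqsum x < +oo)%E >].

Lemma l2_predP x : reflect (sqsum x < +oo)%E (x \in l2_pred).
Proof. exact: asboolP. Qed.

Fact l2_submod_closed : submod_closed l2_pred.
Proof.
split; first by apply/l2_predP; rewrite sqsum0 ltry.
move=> c x y /l2_predP x2 /l2_predP y2; apply/l2_predP.
apply: le_lt_trans (sqsumD_le _ _ ltr01 ltr01) _.
apply: lte_add_pinfty; apply: lte_mul_pinfty => //; rewrite ?lee_fin ?divr_ge0 //.
apply: le_lt_trans (sqsumZ_le _ _) _.
by apply: lte_mul_pinfty; rewrite ?lee_fin ?sqr_ge0.
Qed.

HB.instance Definition _ :=
  GRing.isSubmodClosed.Build R[i] (I -> R[i]) l2_pred l2_submod_closed.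

Record l2 : Type := L2 { l2_fun :> I -> R[i]; _ : l2_fun \in l2_pred }.

HB.instance Definition _ := [isSub for l2_fun].
HB.instance Definition _ := [Choice of l2 by <:].
HB.instance Definition _ := [SubChoice_isSubLmodule of l2 by <:].

Implicit Types u v : l2.

Definition l2_norm u : R[i] := (Num.sqrt (fine (sqsum u)))%:C%C.

Lemma l2_sqsum_fin u : sqsum u \is a fin_num.
Proof. by rewrite ge0_fin_numE ?sqsum_ge0 //; apply/l2_predP; case: u. Qed.

Lemma l2_norm_sqr u :
  sqsum u = (Num.sqrt (fine (sqsum u)) ^+ 2)%:E.
Proof. by rewrite sqr_sqrtr ?fine_ge0 ?sqsum_ge0 // fineK // l2_sqsum_fin. Qed.

Fact l2_norm_eq0 u : l2_norm u = 0 -> u = 0.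
Proof.
move=> [u0]; apply/val_inj; apply: sqsum_eq0.
by rewrite l2_norm_sqr u0 expr0n.
Qed.

Lemma l2_norm_le u (k : R) :
  0 <= k -> (sqsum u <= (k ^+ 2)%:E)%E -> l2_norm u <= k%:C%C.
Proof.
move=> k0; rewrite l2_norm_sqr lee_fin ler_sqr ?nnegrE ?sqrtr_ge0 // => uk.
by rewrite lecR.
Qed.

Fact l2_normD u v : l2_norm (u + v) <= l2_norm u + l2_norm v.
Proof.
have [/l2_norm_eq0 ->|u0] := eqVneq (l2_norm u) 0;
  first by rewrite add0r lerDr lecR sqrtr_ge0.
have [/l2_norm_eq0 ->|v0] := eqVneq (l2_norm v) 0;
  first by rewrite addr0 lerDl lecR sqrtr_ge0.
have gt0 w : l2_norm w != 0 -> 0 < Num.sqrt (fine (sqsum w)).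
  move=> w0; rewrite lt_def sqrtr_ge0 andbT.
  by apply: contraNneq w0 => w0; rewrite /l2_norm w0.
have {}u0 := gt0 _ u0; have {}v0 := gt0 _ v0.
rewrite {2 3}/l2_norm -rmorphD /=; apply: l2_norm_le; first by rewrite addr_ge0 ?ltW.
apply: le_trans (sqsumD_le _ _ u0 v0) _.
have := l2_norm_sqr v; have := l2_norm_sqr u; move: u0 v0.
move: (Num.sqrt _) (Num.sqrt _) => p q p0 q0 -> ->.
rewrite -!EFinM -EFinD lee_fin le_eqVlt; apply/orP; left; apply/eqP.
by field; rewrite !gt_eqF.
Qed.

Fact l2_normZ (c : R[i]) u : l2_norm (c *: u) = `|c| * l2_norm u.
Proof.
have n0 z : 0 <= normc (z : R[i]) by case: z => ? ?; exact: sqrtr_ge0.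
have le d w : l2_norm (d *: w) <= `|d| * l2_norm w.
  rewrite (_ : `|d| = (normc d)%:C%C) // -rmorphM /=.
  apply: l2_norm_le; first by rewrite mulr_ge0 ?sqrtr_ge0.
  by rewrite exprMn EFinM -l2_norm_sqr; exact: sqsumZ_le.
have [->|c0] := eqVneq c 0.
  by rewrite scale0r normr0 mul0r /l2_norm sqsum0 /= sqrtr0.
apply/eqP; rewrite eq_le le /= -ler_pdivlMl ?normr_gt0 // -normfV.
by rewrite -{1}[u](scalerK c0).
Qed.

HB.instance Definition _ := Lmodule_isNormed.Build R[i] l2
  l2_normD l2_normZ l2_norm_eq0.

(* <u, v> = \sum_i u i * (v i)^*, as the limit of the net of finite partial sums *)
Definition l2_dot u v : R[i] :=
  summability.sum (fun i => (u i * (v i)^*)%C : (R[i] : numFieldType)).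

End SquareSum.

Section Operators.
Variables (R : realType) (I : choiceType).
Implicit Types (T : l2 R I -> l2 R I) (u v : l2 R I).

Definition bounded_operator T : Prop :=
  linear T /\ exists M : R, forall u, `|T u| <= M%:C%C * `|u|.

Definition is_adjoint T T' : Prop :=
  forall u v, l2_dot (T u) v = l2_dot u (T' v).

(* operator-norm closure: |T - S| <= e means |T u - S u| <= e |u| for all u *)
Definition norm_closure (A : set (l2 R I -> l2 R I)) : set (l2 R I -> l2 R I) :=
  [set T | bounded_operator T /\ forall e : R, 0 < e ->
    exists2 S, A S & forall u, `|T u - S u| <= e%:C%C * `|u|].

End Operators.

(* A and B are meant to be *-subalgebras of bounded operators; the values of Phi
   outside A are irrelevant.  Each T in A has its adjoint in A, so the last clause
   says that Phi sends the adjoint of T to the adjoint of Phi T. *)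
Definition star_isomorphic (R : realType) (I J : choiceType)
    (A : set (l2 R I -> l2 R I)) (B : set (l2 R J -> l2 R J)) : Prop :=
  exists Phi : (l2 R I -> l2 R I) -> (l2 R J -> l2 R J),
  [/\ set_bij A B Phi,
      forall T1 T2, A T1 -> A T2 -> Phi (T1 + T2) = Phi T1 + Phi T2,
      forall (c : R[i]) T, A T -> Phi (c *: T) = c *: Phi T,
      forall T1 T2, A T1 -> A T2 -> Phi (T1 \o T2) = Phi T1 \o Phi T2
    & forall T T', A T -> A T' -> is_adjoint T T' -> is_adjoint (Phi T) (Phi T')].

(* We take the regular representation induced by the faithful representation of
   l_oo(G) on l^2(G) by multiplication.  It acts on l^2(G; l^2(G)), written as
   l^2(G * G): the first index is that of the translation operators, the second
   that of the copy of l^2(G) on which l_oo(G) is represented.  With (s, x) the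
   indices and alpha the action of G on l_oo(G),
     (pi(f) u) (s, x) = (alpha_(s^-1) f) x * u (s, x)
     (lambda_g u) (s, x) = u (g^-1 s, x). *)
Section CrossedProduct.
Variables (R : realType) (G : groupType).

Record linf : Type := Linf {
  linf_fun :> G -> R[i];
  linf_bounded : exists M : R, forall x, normc (linf_fun x) <= M }.

Implicit Types (f : linf) (g s x : G) (u : l2 R (G * G)%type).

Fact translate_subproof g f :
  exists M : R, forall x, normc (f (g^-1 * x)%g) <= M.
Proof. by have [M fM] := linf_bounded f; exists M. Qed.

Definition translate g f : linf := Linf (translate_subproof g f).

Fact crossed_pi_subproof f u :
  (fun p : G * G => translate p.1^-1%g f p.2 * u p) \in @l2_pred R (G * G)%type.
Proof.
have [M fM] := linf_bounded f; apply/l2_predP.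
have n0 z : 0 <= normc (z : R[i]) by case: z => ? ?; exact: sqrtr_ge0.
apply: (@le_lt_trans _ _ ((M ^+ 2)%:E * sqsum u)%E).
  apply: sqsum_le_scale; first exact: sqr_ge0.
  move=> p; rewrite normcM exprMn ler_wpM2r ?sqr_ge0 //.
  by rewrite ler_sqr ?nnegrE ?fM ?n0 // (le_trans (n0 _) (fM 1%g)).
apply: lte_mul_pinfty; rewrite ?lee_fin ?sqr_ge0 //.
by apply/l2_predP; case: u.
Qed.

Definition crossed_pi f u : l2 R (G * G)%type := L2 (crossed_pi_subproof f u).

Fact crossed_lambda_subproof g u :
  (fun p : G * G => u ((g^-1 * p.1)%g, p.2)) \in @l2_pred R (G * G)%type.
Proof.
apply/l2_predP.
have -> : (fun p => u ((g^-1 * p.1)%g, p.2)) = u \o (fun p => ((g^-1 * p.1)%g, p.2)).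
  by [].
rewrite (sqsum_reindex (q := fun p => ((g * p.1)%g, p.2))).
- by apply/l2_predP; case: u.
- by move=> [s x] /=; rewrite mulVKg.
- by move=> [s x] /=; rewrite mulKg.
Qed.

Definition crossed_lambda g u : l2 R (G * G)%type := L2 (crossed_lambda_subproof g u).

Lemma crossed_covariant g f u :
  crossed_lambda g (crossed_pi f (crossed_lambda g^-1%g u)) =
  crossed_pi (translate g f) u.
Proof.
apply/val_inj/funext => -[s x] /=.
by rewrite !invgM !invgK mulVKg -mulgA.
Qed.

Definition algebraic_crossed_product :
    set (l2 R (G * G)%type -> l2 R (G * G)%type) :=
  [set T | exists (n : nat) (f : 'I_n -> linf) (g : 'I_n -> G),
    T = \sum_(k < n) (crossed_pi (f k) \o crossed_lambda (g k))].

Definition reduced_crossed_product :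
    set (l2 R (G * G)%type -> l2 R (G * G)%type) :=
  norm_closure algebraic_crossed_product.

End CrossedProduct.

Arguments translate {R G}.
Arguments crossed_pi {R G}.
Arguments crossed_lambda {R G}.
Arguments algebraic_crossed_product R G : clear implicits.
Arguments reduced_crossed_product R G : clear implicits.

(* Main.v *)
Require Import Defs.
From HB Require Import structures.
From mathcomp Require Import all_boot all_order all_algebra finmap complex.
From mathcomp Require Import all_classical all_reals all_analysis.
From mathcomp Require summability.
From mathcomp Require Import ring lra.

(* A star-isomorphism sends the diagonal matrix units of one algebra to rank-one
   projections of the other, so it is implemented by a unitary matrix u, and
   m(x, y) = |u(x, y)|^2 is doubly stochastic. For every bounded f the sum
   \sum_x f(x) u(x, y) conj(u(g x, y')) is the kernel of an operator approximable
   in norm by operators of finite propagation, and by Schur's theorem (weakly null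
   sequences of l^1 are norm null) the consequences of approximability which are
   seen by absolutely summable functionals of f are uniform over the unit ball of
   l^oo. A choice of signs then shows that row x is concentrated, in the average for
   m(-, y), around y. Hence every row and every column has an entry m(x, y) >= d
   with d independent of the row or column and is concentrated near it, and the
   relation m(x, y) >= d is a coarse correspondence.

   An injection close to this correspondence is a matching, which exists by Hall's
   criterion: each finite A must have at least |A| points B at bounded distance from
   its partners. Double stochasticity gives |B| >= (1 - e) |A|, enough if the target
   group expands all its finite sets. Otherwise it has Foelner sets, averaging over
   their translates localizes the projection onto the rows in A, and the vectors
   supported off B lose at least half of their mass under this projection, so no
   nonzero combination of the rows in A vanishes on B. Cantor-Bernstein combines
   two injections into a bijection close to the correspondence.

   Conversely a bijection of the groups that is bi-Lipschitz for the right-invariant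
   metrics conjugates each translation into a finite sum of weighted translations. *)

Set Implicit Arguments.
Unset Strict Implicit.
Unset Printing Implicit Defensive.

Import Order.TTheory GRing.Theory Num.Theory.
Import numFieldNormedType.Exports.
Import ComplexField.Normc.

Local Open Scope classical_set_scope.
Local Open Scope fset_scope.
Local Open Scope ring_scope.

(** * Complex moduli and unordered sums *)

Section ComplexModulus.
Variable R : realType.
Implicit Types (z w : R[i]).

Lemma normc_ge0 z : 0 <= normc z.
Proof. by case: z => a b; exact: sqrtr_ge0. Qed.

Lemma normc_conj z : normc (z^*)%C = normc z.
Proof. by case: z => a b /=; rewrite sqrrN. Qed.

Lemma normc_real (r : R) : normc (r%:C)%C = `|r|.
Proof. by rewrite /= expr0n /= addr0 sqrtr_sqr. Qed.

Lemma mulc_conj z : z * (z^*)%C = ((normc z ^+ 2)%:C)%C.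
Proof.
case: z => a b; rewrite /= sqr_sqrtr ?addr_ge0 ?sqr_ge0 //.
by apply/eqP; rewrite eq_complex /=; apply/andP; split; apply/eqP; ring.
Qed.

Lemma normc_eq0 z : (normc z == 0) = (z == 0).
Proof. by apply/eqP/eqP => [/eq0_normc|->] //; rewrite normc0. Qed.

Lemma normc_sum (I : Type) (s : seq I) (P : pred I) (f : I -> R[i]) :
  normc (\sum_(i <- s | P i) f i) <= \sum_(i <- s | P i) normc (f i).
Proof.
elim/big_rec2: _ => [|i x y _ le_xy]; first by rewrite normc0.
by apply: le_trans (le_normcD _ _) _; rewrite lerD2l.
Qed.

Lemma conjc_sum (I : Type) (s : seq I) (P : pred I) (f : I -> R[i]) :
  ((\sum_(i <- s | P i) f i)^*)%C = \sum_(i <- s | P i) ((f i)^*)%C.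
Proof. exact: (big_morph _ (rmorphD _) (rmorph0 _)). Qed.

Lemma realc_sum (I : Type) (s : seq I) (P : pred I) (f : I -> R) :
  ((\sum_(i <- s | P i) f i)%:C)%C = \sum_(i <- s | P i) ((f i)%:C)%C.
Proof. exact: (big_morph _ (rmorphD _) (rmorph0 _)). Qed.

(** Lagrange's identity: the double sum of the squares [(a i * b j - a j * b i) ^+ 2] is twice the
    difference of the two sides. *)
Lemma cauchy_schwarz_real (I : Type) (s : seq I) (a b : I -> R) :
  (\sum_(i <- s) a i * b i) ^+ 2 <= (\sum_(i <- s) a i ^+ 2) * (\sum_(i <- s) b i ^+ 2).
Proof.
have h : 0 <= \sum_(i <- s) \sum_(j <- s) (a i * b j - a j * b i) ^+ 2.
  by apply: sumr_ge0 => i _; apply: sumr_ge0 => j _; exact: sqr_ge0.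
have e : \sum_(i <- s) \sum_(j <- s) (a i * b j - a j * b i) ^+ 2 =
   2 * ((\sum_(i <- s) a i ^+ 2) * (\sum_(i <- s) b i ^+ 2)
        - (\sum_(i <- s) a i * b i) ^+ 2).
  transitivity (\sum_(i <- s) \sum_(j <- s)
     (a i ^+ 2 * b j ^+ 2 + b i ^+ 2 * a j ^+ 2 - 2 * ((a i * b i) * (a j * b j)))).
    by apply: eq_bigr => i _; apply: eq_bigr => j _; ring.
  under eq_bigr do rewrite sumrB big_split /= -!mulr_sumr.
  rewrite sumrB big_split /= -!mulr_suml -mulr_sumr -mulr_suml; ring.
by move: h; rewrite e pmulr_rge0 // subr_ge0.
Qed.

Lemma cauchy_schwarz (I : Type) (s : seq I) (a b : I -> R[i]) :
  normc (\sum_(i <- s) a i * b i) ^+ 2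
  <= (\sum_(i <- s) normc (a i) ^+ 2) * (\sum_(i <- s) normc (b i) ^+ 2).
Proof.
apply: le_trans (cauchy_schwarz_real s _ _).
rewrite ler_sqr ?nnegrE ?normc_ge0 ?sumr_ge0 // => [|i _].
  by apply: le_trans (normc_sum _ _ _) _; apply: ler_sum => i _; rewrite normcM.
by rewrite mulr_ge0 ?normc_ge0.
Qed.

(** The factor rotating [z] onto its modulus. At [z = 0] division by zero gives [0], so its modulus
    is at most 1 in every case. *)
Definition phase z : R[i] := (z^*)%C / ((normc z)%:C)%C.

Lemma normc_phase_le1 z : normc (phase z) <= 1.
Proof.
rewrite /phase normcM normc_conj normcV normc_real ger0_norm ?normc_ge0 //.
have [->|z0] := eqVneq (normc z) 0; first by rewrite mul0r ler01.
by rewrite divff.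
Qed.

Lemma phaseM z : phase z * z = ((normc z)%:C)%C.
Proof.
have [->|z0] := eqVneq z 0; first by rewrite mulr0 normc0.
have n0 : ((normc z)%:C)%C != 0 :> R[i].
  by rewrite eq_complex /= eqxx andbT normc_eq0.
rewrite /phase mulrAC [_ * z]mulrC mulc_conj expr2 rmorphM /= mulfK //.
Qed.

End ComplexModulus.

Arguments normc : simpl never.

Section FsetSums.
Variables (R : realType) (I : choiceType).
Implicit Types (F E : {fset I}).

Lemma sum_fset_le E F (r : I -> R) : (forall i, 0 <= r i) -> E `<=` F ->
  \sum_(i <- E) r i <= \sum_(i <- F) r i.
Proof.
move=> r0 EF; rewrite [leRHS](big_fsetID _ (mem E)) /=.
rewrite (_ : [fset x | x in F & x \in E] = E); last first.
  apply/fsetP => x; rewrite !inE /=; case xE: (x \in E); rewrite ?andbF ?andbT //.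
  exact: (fsubsetP EF).
by rewrite lerDl sumr_ge0.
Qed.

Lemma sum_fsetD (V : nmodType) E F (f : I -> V) : E `<=` F ->
  \sum_(i <- F) f i = \sum_(i <- E) f i + \sum_(i <- F `\` E) f i.
Proof.
move=> EF; rewrite (big_fsetID _ (mem E)) /=; congr (_ + _); apply: eq_fbigl => x.
  rewrite !inE /=; case xE: (x \in E); rewrite ?andbF ?andbT //.
  exact: (fsubsetP EF).
by rewrite !inE andbC.
Qed.

Lemma sum_fset_single (V : nmodType) F (f : I -> V) i0 :
  (forall i, i != i0 -> f i = 0) -> i0 \in F -> \sum_(i <- F) f i = f i0.
Proof.
move=> f0 iF; rewrite (big_fsetD1 i0) //= big_seq big1 ?addr0 // => i.
by rewrite !inE => /andP[/f0].
Qed.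

End FsetSums.

Section HasSum.
Variable R : realType.

Definition has_sum (I : choiceType) (c : I -> R[i]) (s : R[i]) : Prop :=
  forall e : R, 0 < e -> exists F : {fset I}, forall F' : {fset I}, F `<=` F' ->
    normc (\sum_(i <- F') c i - s) <= e.

Variable I : choiceType.
Implicit Types (c d : I -> R[i]) (s t : R[i]).

Lemma has_sum_ext c d s : c =1 d -> has_sum c s -> has_sum d s.
Proof. by move=> /funext ->. Qed.

Lemma has_sum_uniq c s t : has_sum c s -> has_sum c t -> s = t.
Proof.
move=> cs ct; apply/eqP; rewrite -subr_eq0 -normc_eq0 eq_le normc_ge0 andbT.
apply/ler_addgt0Pr => e e0; rewrite add0r; have e2 : 0 < e / 2 by rewrite divr_gt0.
have [F hF] := cs _ e2; have [F' hF'] := ct _ e2.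
have /(_ (fsubsetUl _ _)) h1 := hF (F `|` F').
have /(_ (fsubsetUr _ _)) h2 := hF' (F `|` F').
set S := \sum_(i <- _) _ in h1 h2.
have -> : s - t = (S - t) + - (S - s) by ring.
by rewrite (le_trans (le_normcD _ _)) // normcN; lra.
Qed.

Lemma has_sumD c d s t : has_sum c s -> has_sum d t ->
  has_sum (fun i => c i + d i) (s + t).
Proof.
move=> cs ct e e0; have e2 : 0 < e / 2 by rewrite divr_gt0.
have [F hF] := cs _ e2; have [F' hF'] := ct _ e2; exists (F `|` F') => G.
rewrite fsubUset => /andP[/hF h1 /hF' h2].
rewrite big_split /= opprD addrACA (le_trans (le_normcD _ _)) //; lra.
Qed.

Lemma has_sumZ a c s : has_sum c s -> has_sum (fun i => a * c i) (a * s).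
Proof.
move=> cs e e0; have a1 : 0 < normc a + 1 by have := normc_ge0 a; lra.
have [F hF] := cs _ (divr_gt0 e0 a1); exists F => G /hF h.
rewrite -mulr_sumr -mulrBr normcM.
apply: le_trans (_ : (normc a + 1) * (e / (normc a + 1)) <= _); last first.
  by rewrite mulrC divfK // gt_eqF.
by rewrite ler_pM ?normc_ge0 // lerDl.
Qed.

Lemma has_sum0 : has_sum (fun _ : I => 0) 0.
Proof. by move=> e e0; exists fset0 => F _; rewrite big1 // subr0 normc0 ltW. Qed.

Lemma has_sum_big (J : Type) (r : seq J) (c : J -> I -> R[i]) (s : J -> R[i]) :
  (forall j, has_sum (c j) (s j)) ->
  has_sum (fun i => \sum_(j <- r) c j i) (\sum_(j <- r) s j).
Proof.
move=> cs; elim: r => [|j r IH].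
  rewrite big_nil; apply: has_sum_ext has_sum0 => i; by rewrite big_nil.
rewrite big_cons; apply: has_sum_ext (has_sumD (cs j) IH) => i.
by rewrite big_cons.
Qed.

Lemma has_sum_single c i0 : (forall i, i != i0 -> c i = 0) -> has_sum c (c i0).
Proof.
move=> c0 e e0; exists [fset i0] => F; rewrite fsub1set => iF.
by rewrite (sum_fset_single c0) // subrr normc0 ltW.
Qed.

Lemma has_sum_real_le (r : I -> R) (s : R) (F : {fset I}) : (forall i, 0 <= r i) ->
  has_sum (fun i => (r i)%:C)%C (s%:C)%C -> \sum_(i <- F) r i <= s.
Proof.
move=> r0 rs; apply/ler_addgt0Pr => e e0.
have [F0 /(_ (F `|` F0) (fsubsetUr _ _))] := rs _ e0.
rewrite -realc_sum -rmorphB normc_real => h.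
apply: le_trans (sum_fset_le r0 (fsubsetUl F F0)) _.
by have := le_trans (ler_norm _) h; rewrite lerBlDl.
Qed.

Lemma has_sum_real_ge (r : I -> R) (s e : R) : 0 < e ->
  has_sum (fun i => (r i)%:C)%C (s%:C)%C ->
  exists F : {fset I}, s - e <= \sum_(i <- F) r i.
Proof.
move=> e0 /(_ e e0)[F /(_ F (fsubset_refl _))]; rewrite -realc_sum -rmorphB normc_real => h.
by exists F; rewrite lerBlDl -lerBlDr (le_trans (ler_norm _)) // distrC.
Qed.

End HasSum.

Lemma has_sum_inj (R : realType) (I J : choiceType) (h : I -> J) (c : J -> R[i]) s :
  injective h -> (forall j, (forall i, h i != j) -> c j = 0) ->
  has_sum c s -> has_sum (c \o h) s.
Proof.
move=> hI c0 cs e e0; have [F hF] := cs _ e0.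
(* Since [h] is injective, the preimage of [F] is finite; it is built by removing one point of [F]
   at a time. *)
have [E hE] : exists E : {fset I}, forall i, h i \in F -> i \in E.
  elim/finSet_rect: F {hF} => F IH.
  have [->|[j jF]] := fset_0Vmem F; first by exists fset0.
  have [|E hE] := IH (F `\ j); first by rewrite fproperD1.
  have [[i ij]|nij] := pselect (exists i, h i = j).
    exists (i |` E) => i' hi'; rewrite !inE; apply/orP.
    have [e1|ne] := eqVneq (h i') j; first by left; apply/eqP/hI; rewrite ij.
    by right; apply: hE; rewrite !inE ne.
  exists E => i hi; apply: hE; rewrite !inE hi andbT.
  by apply/eqP => e1; apply: nij; exists i.
exists E => E' EE'.
have /= := hF (F `|` (h @` E')) (fsubsetUl _ _).
rewrite (_ : \sum_(i <- F `|` _) c i = \sum_(i <- E') c (h i)) //.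
rewrite [RHS](_ : _ = \sum_(j <- h @` E') c j); last first.
  by rewrite big_imfset //= => ? ? _ _ /hI.
rewrite (sum_fsetD _ (fsubsetUr F (h @` E'))) [X in _ + X]big1_seq ?addr0 // => j.
rewrite !inE => /andP[_ /andP[/[dup] /negP jE /negPf ->]]; rewrite orbF => jF.
apply: c0 => i; apply/eqP => ij; apply: jE; rewrite -ij in jF *.
by apply/imfsetP; exists i => //; apply: (fsubsetP EE'); exact: hE.
Qed.

(** * Schur's theorem *)

Section GlidingHump.
Variables (R : realType) (X : choiceType) (T : Type) (lev : T -> nat).
Variables (c : T -> X -> R[i]) (M : T -> R).
Hypothesis cM : forall t (F : {fset X}), \sum_(x <- F) normc (c t x) <= M t.
Hypothesis c_weak : forall f : X -> R[i], (forall x, normc (f x) <= 1) ->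
  forall e : R, 0 < e -> exists n, forall t, (n <= lev t)%N ->
  exists2 s, has_sum (fun x => f x * c t x) s & normc s <= e.

(** A finite set nearly attaining the supremum of the finite sums leaves at most [e] for anything
    disjoint from it. *)
Let tail_small t (e : R) : 0 < e -> exists E : {fset X}, forall F : {fset X},
  [disjoint E & F] -> \sum_(x <- F) normc (c t x) <= e.
Proof.
move=> e0; pose A := [set r | exists F : {fset X}, r = \sum_(x <- F) normc (c t x)]%classic.
have supA : has_sup A.
  split; first by exists 0, fset0; rewrite big_seq_fset0.
  by exists (M t) => _ [F ->].
have [_ [E ->] hE] := sup_adherent e0 supA.
exists E => F dEF; have : \sum_(x <- E `|` F) normc (c t x) <= sup A.
  by apply: ub_le_sup; [case: supA | exists (E `|` F)].
rewrite (sum_fsetD _ (fsubsetUl E F)) fsetDUl fsetDv fset0U.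
have -> : F `\` E = F by apply/fsetDidPl; rewrite fdisjoint_sym.
by move: hE; lra.
Qed.

Let coef_small x e : 0 < e -> exists n, forall t, (n <= lev t)%N -> normc (c t x) <= e.
Proof.
move=> e0; have [|n hn] := @c_weak (fun y => if y == x then 1 else 0) _ e e0.
  by move=> y; case: ifP; rewrite ?normc1 ?normc0.
exists n => t /hn[s hs]; have := @has_sum_single R X (fun y => (if y == x then 1 else 0) * c t y) x.
rewrite eqxx mul1r => hx.
by rewrite (has_sum_uniq (hx _) hs) // => y /negPf ->; rewrite mul0r.
Qed.

Let head_small (E : {fset X}) e : 0 < e -> exists n, forall t, (n <= lev t)%N ->
  \sum_(x <- E) normc (c t x) <= e.
Proof.
elim/finSet_rect: E e => E IH e e0.
have [->|[x xE]] := fset_0Vmem E; first by exists 0%N => t _; rewrite big_seq_fset0 ltW.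
have e2 : 0 < e / 2 by rewrite divr_gt0.
have [|n hn] := IH (E `\ x) _ _ e2; first by rewrite fproperD1.
have [m hm] := coef_small x e2; exists (maxn n m) => t.
rewrite geq_max => /andP[/hn h1 /hm h2]; rewrite (big_fsetD1 x) //=; lra.
Qed.

(* Schur's theorem on l^1 by a gliding hump: otherwise one finds tests [t k] of
   increasing level carrying most of their mass on disjoint finite sets, and a
   single [f] aligned with all of them. *)
Lemma weak_null_norm_null e : 0 < e -> exists n, forall t, (n <= lev t)%N ->
  forall F : {fset X}, \sum_(x <- F) normc (c t x) <= e.
Proof.
move=> e0; apply: contrapT => nex.
(* The middle block of a test keeps more than 7e/8, while the head, the tail, the value at [f] and
   the error of a partial sum are at most e/8 each, hence e/2 in all. *)
have e8 : 0 < e / 8 by rewrite divr_gt0.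
have step (E : {fset X}) n : exists p : T * {fset X},
    [/\ (n <= lev p.1)%N, E `<=` p.2, \sum_(x <- E) normc (c p.1 x) <= e / 8,
        e < \sum_(x <- p.2) normc (c p.1 x) &
        forall F : {fset X}, [disjoint p.2 & F] -> \sum_(x <- F) normc (c p.1 x) <= e / 8].
  have [m hm] := head_small E e8.
  apply: contrapT => np; apply: nex; exists (maxn n m) => t.
  rewrite geq_max => /andP[nt /hm hE] F; rewrite leNgt; apply/negP => hF.
  have [D hD] := tail_small t e8; apply: np; exists (t, E `|` F `|` D); split => //=.
  - by rewrite -fsetUA fsubsetUl.
  - apply: lt_le_trans hF _; apply: sum_fset_le => [x|]; first exact: normc_ge0.
    by rewrite fsetUAC fsubsetUr.
  - by move=> G; rewrite fdisjointUX => /andP[_ /hD].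
pose st E n := projT1 (cid (step E n)).
have stP E n := projT2 (cid (step E n)).
pose E := fix E k := if k is k'.+1 then (st (E k') k').2 else fset0 : {fset X}.
pose t k := (st (E k) k).1.
have E_incr k l : (k <= l)%N -> E k `<=` E l.
  move=> /subnK <-; elim: (l - k)%N => // d IH; rewrite addSn /=.
  apply: fsubset_trans IH _; by have [_] := stP (E (d + k)%N) (d + k)%N.
(* The sets [E k] increase, so the least [k] names the only block [E k.+1 \ E k] that contains [x];
   [f] is aligned there with the test [t k]. *)
pose f x := if pselect (exists k, x \in E k.+1) is left h
  then phase (c (t (ex_minn h)) x) else 0.
have f1 x : normc (f x) <= 1.
  rewrite /f; case: pselect => [h|_]; first exact: normc_phase_le1.
  by rewrite normc0.
have fE k x : x \in E k.+1 `\` E k -> f x * c (t k) x = (normc (c (t k) x))%:C%C.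
  rewrite inE => /andP[xk xk1]; rewrite /f; case: pselect => [h|]; last by case; exists k.
  case: ex_minnP => l xl lmin; suff -> : l = k by exact: phaseM.
  apply/eqP; rewrite eqn_leq lmin // leqNgt; apply: contra xk => lk.
  exact: (fsubsetP (E_incr _ _ lk)).
(* The test [t n] has level at least [n], so the threshold [n] attached to [f] applies to that very
   test. *)
have [n /(_ (t n))] := c_weak f1 e8.
have [nlev EE hE bigE tailE] := stP (E n) n.
move=> /(_ nlev) [s fs s8].
have [F hF] := fs _ e8.
have {hF} := hF (E n.+1 `|` F) (fsubsetUr _ _).
rewrite (sum_fsetD _ (fsubsetUl _ _)) (sum_fsetD _ EE).
have nf (D : {fset X}) : normc (\sum_(x <- D) f x * c (t n) x) <= \sum_(x <- D) normc (c (t n) x).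
  apply: le_trans (normc_sum _ _ _) _; apply: ler_sum => x _; rewrite normcM.
  by rewrite ler_piMl ?normc_ge0.
have mid : \sum_(x <- E n.+1 `\` E n) f x * c (t n) x =
    ((\sum_(x <- E n.+1 `\` E n) normc (c (t n) x))%:C)%C.
  by rewrite realc_sum big_seq [RHS]big_seq; apply: eq_bigr => x /fE.
have dj (A B : {fset X}) : [disjoint A & (A `|` B) `\` A].
  by apply/fdisjointP => x xA; rewrite !inE xA.
have head := le_trans (nf (E n)) hE.
have tail := le_trans (nf ((E n.+1 `|` F) `\` E n.+1)) (tailE _ (dj (E n.+1) F)).
move: bigE; rewrite (sum_fsetD _ EE) -/(t n) -/(E n.+1) => bigE.
rewrite mid; set h := \sum_(x <- E n) f x * _ in head *.
set r := \sum_(x <- _ `\` E n.+1) _ in tail *.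
set q := \sum_(x <- E n.+1 `\` E n) _ in bigE *.
move=> hh.
have : normc (q%:C)%C <= normc (h + (q%:C)%C + r - s) + normc h + normc r + normc s.
  rewrite {1}(_ : (q%:C)%C = (h + (q%:C)%C + r - s) + - h + - r + s); last by ring.
  apply: le_trans (le_normcD _ _) _; rewrite lerD2r.
  apply: le_trans (le_normcD _ _) _; rewrite normcN lerD2r.
  by apply: le_trans (le_normcD _ _) _; rewrite normcN.
rewrite normc_real ger0_norm; last by apply: sumr_ge0 => *; exact: normc_ge0.
move: bigE hE head tail s8 hh; rewrite -/(t n); lra.
Qed.

End GlidingHump.

(* By the parallelogram law one of the two signs does not decrease the sum of the squared norms. *)
Lemma exists_signs (R : realType) (X Y : choiceType) (E : seq X) (Z : seq Y) (v : X -> Y -> R[i]) :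
  uniq E ->
  exists f : X -> R[i], (forall x, normc (f x) <= 1) /\
  \sum_(x <- E) \sum_(y <- Z) normc (v x y) ^+ 2 <=
  \sum_(y <- Z) normc (\sum_(x <- E) f x * v x y) ^+ 2.
Proof.
elim: E => [_|x E IH /= /andP[xE /IH[f [f1 hf]]]].
  exists (fun => 0); split => [x|]; first by rewrite normc0.
  by rewrite !big_nil sumr_ge0 // => y _; exact: sqr_ge0.
pose g (s : bool) (x' : X) : R[i] := if x' == x then (-1) ^+ s else f x'.
have g1 s x' : normc (g s x') <= 1.
  by rewrite /g; case: ifP => // _; case: s; rewrite ?expr1 ?normcN normc1.
have gE s y : \sum_(x' <- x :: E) g s x' * v x' y =
    (-1) ^+ s * v x y + \sum_(x' <- E) f x' * v x' y.
  rewrite big_cons /g eqxx; congr (_ + _); rewrite big_seq [RHS]big_seq.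
  by apply: eq_bigr => x' x'E; case: eqP x'E xE => // -> ->.
have par (a b : R[i]) : normc (a + b) ^+ 2 + normc (- a + b) ^+ 2
    = 2 * (normc a ^+ 2 + normc b ^+ 2).
  have ex z : normc z ^+ 2 = complex.Re z ^+ 2 + complex.Im z ^+ 2 :> R.
    by case: z => p q; rewrite /normc sqr_sqrtr ?addr_ge0 ?sqr_ge0.
  by rewrite !ex; case: a b => p q [p' q'] /=; ring.
pose S s := \sum_(y <- Z) normc (\sum_(x' <- x :: E) g s x' * v x' y) ^+ 2.
have SS : S false + S true = 2 * (\sum_(y <- Z) normc (v x y) ^+ 2
    + \sum_(y <- Z) normc (\sum_(x' <- E) f x' * v x' y) ^+ 2).
  rewrite -!big_split mulr_sumr; apply: eq_bigr => y _ /=.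
  by rewrite !gE expr1 expr0 mulN1r mul1r par.
have [h|h] := leP (S true) (S false).
  exists (g false); split => //; rewrite big_cons -/(S false); move: SS h hf; lra.
exists (g true); split => //; rewrite big_cons -/(S true); move: SS h hf; lra.
Qed.

(** * Infinite marriage and Cantor-Bernstein *)

Section Marriage.
Variables (X Y : choiceType).
Implicit Types (A : X -> {fset Y}) (F : {fset X}) (x : X) (y : Y).

Definition hall A : Prop :=
  forall F, (#|` F| <= #|` \bigcup_(x <- F) A x|)%N.

Definition shrink A x y : X -> {fset Y} :=
  fun z => if z == x then A x `\ y else A z.

Lemma hall_neq0 A x : hall A -> exists y, y \in A x.
Proof.
move=> /(_ [fset x]); rewrite big_seq_fset1 cardfs1 => h.
by have [e|[y yA]] := fset_0Vmem (A x); [rewrite e cardfs0 in h | exists y].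
Qed.

(** A set violating Hall's condition after the deletion must contain [x], the only point whose
    neighbourhood changed; [F] is this set without [x]. *)
Lemma not_hall_shrink A x y : hall A -> ~ hall (shrink A x y) ->
  exists2 F : {fset X}, x \notin F & (#|` (A x `\ y) `|` \bigcup_(z <- F) A z| <= #|` F|)%N.
Proof.
move=> hA /existsNP[F]; move/negP; rewrite -ltnNge => hF.
have eqU E : x \notin E -> \bigcup_(z <- E) shrink A x y z = \bigcup_(z <- E) A z.
  move=> xE; rewrite big_seq [RHS]big_seq; apply: eq_bigr => z zE.
  by rewrite /shrink; case: eqP zE xE => // -> ->.
have [xF|xF] := boolP (x \in F); last first.
  by move: hF; rewrite eqU // ltnNge hA.
exists (F `\ x); first by rewrite !inE eqxx.
move: hF; rewrite (cardfsD1 x F) xF add1n ltnS (big_fsetD1 x) //=.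
by rewrite eqU ?inE ?eqxx // /shrink eqxx.
Qed.

(* Rado's argument: if both deletions fail, the two deficient sets contradict
   submodularity of [F |-> #|\bigcup_(z in F) A z|]. *)
Lemma hall_shrink A x y1 y2 : hall A -> y1 \in A x -> y1 != y2 ->
  hall (shrink A x y1) \/ hall (shrink A x y2).
Proof.
move=> hA y1A y12; apply: contrapT => /not_orP[/(not_hall_shrink hA)[I xI hI]].
move=> /(not_hall_shrink hA)[J xJ hJ].
set P := (A x `\ y1) `|` _ in hI; set Q := (A x `\ y2) `|` _ in hJ.
have subU (E E' : {fset X}) : E `<=` E' ->
    \bigcup_(z <- E) A z `<=` \bigcup_(z <- E') A z.
  by move=> /fsubsetP EE; apply/bigfcupsP => z zE _; apply: bigfcup_sup => //; exact: EE.
(* As [y1] and [y2] differ, [P] and [Q] together cover all of [A x], so Hall's condition can be used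
   with the extra point [x]; this one unit yields the contradiction. *)
have h1 : (#|` I `|` J|.+1 <= #|` P `|` Q|)%N.
  have := hA (x |` (I `|` J)).
  rewrite cardfsU1 !inE (negPf xI) (negPf xJ) add1n => /leq_trans; apply.
  apply: fsubset_leq_card; apply/bigfcupsP => z; rewrite !inE => zE _.
  have [->|zx] := eqVneq z x.
    apply/fsubsetP => y yA; rewrite !inE yA !andbT.
    by have [->|] := eqVneq y y1; rewrite ?y12 ?orbT.
  move: zE; rewrite (negPf zx) /= => /orP[zI|zJ].
    by apply/fsubsetP => y yA; rewrite inE; apply/orP; left; rewrite inE; apply/orP; right;
       apply/bigfcupP; exists z => //; rewrite zI.
  by apply/fsubsetP => y yA; rewrite inE; apply/orP; right; rewrite inE; apply/orP; right;
       apply/bigfcupP; exists z => //; rewrite zJ.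
have h2 : (#|` I `&` J| <= #|` P `&` Q|)%N.
  apply: leq_trans (hA _) _; apply: fsubset_leq_card.
  rewrite fsubsetI; apply/andP; split.
    by apply: fsubset_trans (subU _ _ (fsubsetIl I J)) _; exact: fsubsetUr.
  by apply: fsubset_trans (subU _ _ (fsubsetIr I J)) _; exact: fsubsetUr.
have := leq_add h1 h2; rewrite addSn cardfsUI (cardfsUI P Q) => h3.
by have := leq_trans h3 (leq_add hI hJ); rewrite ltnn.
Qed.

(** As long as [x] has two neighbours, [hall_shrink] allows one of them to be deleted. *)
Lemma hall_single A x : hall A ->
  exists A', [/\ hall A', forall z, A' z `<=` A z & exists y, A' x = [fset y]].
Proof.
have [n] := ubnP #|` A x|; elim: n A => // n IH A An hA.
have [y1 y1A] := hall_neq0 x hA.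
have [e|[y2]] := fset_0Vmem (A x `\ y1).
  exists A; split => //; exists y1.
  apply/fsetP => z; rewrite !inE; apply/idP/eqP => [zA|->//].
  by apply/eqP; move/fsetP/(_ z) : e; rewrite !inE zA andbT => /negbFE.
rewrite !inE => /andP[y21 y2A].
have shr y : y \in A x -> hall (shrink A x y) ->
    exists A', [/\ hall A', forall z, A' z `<=` A z & exists y, A' x = [fset y]].
  move=> yA /IH[].
    by rewrite /shrink eqxx; move: An; rewrite (cardfsD1 y) yA add1n ltnS.
  move=> A' [hA' sub ex]; exists A'; split=> // z.
  apply: fsubset_trans (sub z) _; rewrite /shrink; case: eqP => // ->.
  exact: fsubD1set.
by case: (hall_shrink hA y2A y21) => /shr; apply.
Qed.

(** The points are treated in the order of an enumeration, each neighbourhood being cut down to one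
    point. The families decrease and stay nonempty, so a settled value never changes, and Hall's
    condition for a pair gives injectivity. *)
Lemma marriage A : countable [set: X] -> hall A ->
  exists2 j : X -> Y, injective j & forall x, j x \in A x.
Proof.
move=> /countable_injP[r rI] hA.
have step B x : exists B', hall B -> [/\ hall B', forall z, B' z `<=` B z &
    exists y, B' x = [fset y]].
  have [/(@hall_single _ x)[B' hB']|nB] := pselect (hall B); first by exists B'.
  by exists B.
pose nxt B x := projT1 (cid (step B x)).
have nxtP B x := projT2 (cid (step B x)).
pose next B n := if pselect (exists x, r x = n) is left h then nxt B (projT1 (cid h)) else B.
have nextP B n : hall B -> hall (next B n) /\ forall z, next B n z `<=` B z.
  by move=> hB; rewrite /next; case: pselect => // h; have [] := nxtP B (projT1 (cid h)) hB.
have nextr B x : hall B -> exists y, next B (r x) x = [fset y].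
  move=> hB; rewrite /next; case: pselect => [h|[]]; last by exists x.
  case: cid => /= z /rI zx.
  by have [_ _] := nxtP B z hB; rewrite zx ?inE.
pose B := fix B n := if n is n'.+1 then next (B n') n' else A.
have hB n : hall (B n) by elim: n => //= n /nextP-/(_ n)[].
have sB m n z : (m <= n)%N -> B n z `<=` B m z.
  move=> /subnK <-; elim: (n - m)%N => // d IH; rewrite addSn /=.
  exact: fsubset_trans ((nextP _ _ (hB _)).2 z) IH.
have jex x : exists y, B (r x).+1 x = [fset y] by exact: nextr.
pose j x := projT1 (cid (jex x)).
have jP x n : (r x < n)%N -> B n x = [fset j x].
  move=> rn; have := sB _ _ x rn; rewrite (projT2 (cid (jex x))) -/(j x) fsubset1.
  by case/predU1P=> // e; have [y] := hall_neq0 x (hB n); rewrite (eqP e).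
exists j => [x x' e|x]; last first.
  by apply: (fsubsetP (sB 0%N (r x).+1 x isT)); rewrite jP // inE.
apply/eqP; apply: contraT => xx'.
pose n := (maxn (r x) (r x')).+1.
have := hB n [fset x; x']; rewrite cardfs2 xx'.
have -> : \bigcup_(z <- [fset x; x']) B n z = [fset j x].
  apply/fsetP => y; rewrite inE; apply/bigfcupP/eqP => [[z]|->].
    rewrite !inE andbT => /orP[]/eqP->; rewrite jP ?ltnS ?leq_max ?leqnn ?orbT // inE => /eqP //.
    by rewrite -e.
  by exists x; rewrite ?inE ?eqxx // jP ?ltnS ?leq_max ?leqnn // inE.
by rewrite cardfs1.
Qed.

(** The last clause keeps track of which injection defines [h] at each point, so that closeness to a
    relation passes from [j] and [k] to [h]. *)
Lemma bijection_of_injections (j : X -> Y) (k : Y -> X) : injective j -> injective k ->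
  exists (h : X -> Y) (h' : Y -> X), [/\ cancel h h', cancel h' h &
    forall x, h x = j x \/ k (h x) = x].
Proof.
move=> jI kI.
(* The points reached by [k \o j] from a point outside the range of [k]; [h] is [j] on them and the
   inverse of [k] elsewhere. *)
pose C x := exists n x0, (forall y, k y != x0) /\ x = iter n (k \o j) x0.
have Cran x : ~ C x -> exists y, k y = x.
  move=> nC; apply: contrapT => nk; apply: nC; exists 0%N, x; split => // y.
  by apply/eqP => ky; apply: nk; exists y.
have hex x : exists y, (C x -> y = j x) /\ (~ C x -> k y = x).
  have [Cx|nC] := pselect (C x); first by exists (j x).
  by have [y ky] := Cran x nC; exists y.
pose h x := projT1 (cid (hex x)).
have hC x : C x -> h x = j x by move=> Cx; exact: (projT2 (cid (hex x))).1.
have hN x : ~ C x -> k (h x) = x by move=> Cx; exact: (projT2 (cid (hex x))).2.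
have Ckj x : C x -> C (k (j x)).
  by case=> n [x0 [nk ->]]; exists n.+1, x0.
have hI x x' : h x = h x' -> x = x'.
  case: (pselect (C x)) => Cx; case: (pselect (C x')) => Cx'.
  - by rewrite !hC // => /jI.
  - rewrite hC // => e; case: (Cx'); rewrite -(hN _ Cx') -e; exact: Ckj.
  - rewrite (hC x') // => e; case: (Cx); rewrite -(hN _ Cx) e; exact: Ckj.
  - by move=> e; rewrite -(hN _ Cx) e hN.
have hS y : exists x, h x = y.
  have [[n [x0 [nk ky]]]|nC] := pselect (C (k y)); last first.
    by exists (k y); apply: kI; exact: hN.
  case: n ky => [|n] /= ky; first by have := nk y; rewrite ky eqxx.
  exists (iter n (k \o j) x0); rewrite hC; last by exists n, x0.
  exact/esym/kI.
pose h' y := projT1 (cid (hS y)).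
have h'K : cancel h' h by move=> y; exact: projT2 (cid (hS y)).
exists h, h'; split => // x; first by apply: hI.
by have [/hC|/hN] := pselect (C x); [left | right].
Qed.

End Marriage.

(** * Unitaries conjugating translations to approximable kernels *)

(** Abstracts the metric data of a word length; finiteness of the balls is carried by a function
    into finite sets. *)
Record proper_length (X : groupType) := ProperLength {
  len :> X -> nat;
  len1 : len 1%g = 0%N;
  lenV : forall x, len x^-1%g = len x;
  lenM : forall x y, (len (x * y)%g <= len x + len y)%N;
  length_ball : nat -> {fset X};
  in_length_ball : forall n x, (x \in length_ball n) = (len x <= n)%N }.

Section Approximable.
Variables (R : realType) (Y : groupType) (lY : proper_length Y).

(* [y * y'^-1] is the displacement of left translations, so propagation is
   measured in the right-invariant metric. *)
Definition approximable (K : Y -> Y -> R[i]) : Prop :=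
  forall e : R, 0 < e -> exists (r : nat) (M : R) (S : Y -> Y -> R[i]),
  [/\ forall y y', (r < lY (y * y'^-1)%g)%N -> S y y' = 0,
      forall y y', normc (S y y') <= M &
      forall (v w : Y -> R[i]) (Z : {fset Y}),
        normc (\sum_(y <- Z) \sum_(y' <- Z) (K y y' - S y y') * v y' * w y)
        <= e * (\sum_(y <- Z) normc (v y) ^+ 2 + \sum_(y <- Z) normc (w y) ^+ 2)].

End Approximable.

Section HalfData.
Variables (R : realType) (X Y : groupType) (lY : proper_length Y).
Implicit Type u : X -> Y -> R[i].

(** Applied to [fun y x => conjc (u x y)], it expresses orthonormality of the columns of [u]. *)
Definition orthonormal_rows u : Prop :=
  forall x x', has_sum (fun y => u x y * conjc (u x' y)) (x == x')%:R.

(* [u x] is the image of the basis vector at [x] under a unitary; the sum is the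
   matrix of the conjugate of a generator of the translation algebra. *)
Definition conjugates_approximable u : Prop :=
  forall (g : X) (f : X -> R[i]), (forall x, normc (f x) <= 1) ->
  exists2 K, approximable lY K &
    forall y y', has_sum (fun x => f x * (u x y * conjc (u (g * x)%g y'))) (K y y').

End HalfData.

Section Rows.
Variables (R : realType) (X Y : groupType) (u : X -> Y -> R[i]).
Hypothesis u_orth : orthonormal_rows u.

Lemma row_mass_sum x : has_sum (fun y => (normc (u x y) ^+ 2)%:C%C) (1%:C)%C.
Proof.
have := u_orth x x; rewrite eqxx; apply: has_sum_ext => y; exact: mulc_conj.
Qed.

Lemma row_mass_le x (Z : {fset Y}) : \sum_(y <- Z) normc (u x y) ^+ 2 <= 1.
Proof. by apply: has_sum_real_le (row_mass_sum x) => y; exact: sqr_ge0. Qed.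

Lemma row_mass_ge x (e : R) : 0 < e -> exists Z : {fset Y},
  1 - e <= \sum_(y <- Z) normc (u x y) ^+ 2.
Proof. by move=> e0; exact: has_sum_real_ge (row_mass_sum x). Qed.

End Rows.

(** * Concentration of the doubly stochastic matrix *)

Section Half.
Variables (R : realType) (X Y : groupType) (lY : proper_length Y).
Variable u : X -> Y -> R[i].
Hypothesis u_rows : orthonormal_rows u.
Hypothesis u_cols : orthonormal_rows (fun y x => conjc (u x y)).
Hypothesis u_approx : conjugates_approximable lY u.

Local Notation m x y := (normc (u x y) ^+ 2).

Lemma col_mass_le y (F : {fset X}) : \sum_(x <- F) m x y <= 1.
Proof.
by have := row_mass_le u_cols y F; under eq_bigr do rewrite normc_conj.
Qed.

Lemma col_mass_ge y (e : R) : 0 < e -> exists F : {fset X}, 1 - e <= \sum_(x <- F) m x y.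
Proof.
move=> e0; have [F hF] := row_mass_ge u_cols y e0; exists F; move: hF.
by under eq_bigr do rewrite normc_conj.
Qed.

Lemma mul_le_half_sqrD (a b : R) : a * b <= (a ^+ 2 + b ^+ 2) / 2.
Proof. by have := sqr_ge0 (a - b); rewrite sqrrB mulr2n; lra. Qed.

(** The inequality [2ab <= a^2 + b^2] and two columns of mass at most 1. It makes the families in
    [uniform_tests] absolutely summable. *)
Lemma col_pair_mass_le g y y' (F : {fset X}) :
  \sum_(x <- F) normc (u x y) * normc (u (g * x)%g y') <= 1.
Proof.
apply: le_trans (_ : \sum_(x <- F) (m x y + m (g * x)%g y') / 2 <= _).
  by apply: ler_sum => x _; exact: mul_le_half_sqrD.
rewrite -mulr_suml big_split /=.
have h1 := col_mass_le y F.
have h2 : \sum_(x <- F) m (g * x)%g y' <= 1.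
  have := col_mass_le y' [fset (g * x)%g | x in F].
  by rewrite big_imfset //= => ? ? _ _ /mulgI.
lra.
Qed.

(** Pairing a test [q] with the kernel of [f] evaluates an absolutely summable family in [x] at [f].
    The hypothesis on approximable kernels is weak convergence of these families to zero, and
    [weak_null_norm_null] makes it convergence in norm. *)
Lemma uniform_tests g (valid : nat -> {fset Y} -> (Y -> Y -> R[i]) -> Prop) :
  (forall K, approximable lY K -> forall e : R, 0 < e -> exists N, forall n Z q,
    (N <= n)%N -> valid n Z q ->
    normc (\sum_(y <- Z) \sum_(y' <- Z) q y y' * K y y') <= e) ->
  forall e : R, 0 < e -> exists N, forall n Z q, (N <= n)%N -> valid n Z q ->
    forall F : {fset X}, \sum_(x <- F)
      normc (\sum_(y <- Z) \sum_(y' <- Z) q y y' * (u x y * conjc (u (g * x)%g y'))) <= e.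
Proof.
move=> conv e e0.
pose T := {t : nat * {fset Y} * (Y -> Y -> R[i]) | valid t.1.1 t.1.2 t.2}.
pose c (t : T) x := \sum_(y <- (sval t).1.2) \sum_(y' <- (sval t).1.2)
   (sval t).2 y y' * (u x y * conjc (u (g * x)%g y')).
pose M (t : T) := \sum_(y <- (sval t).1.2) \sum_(y' <- (sval t).1.2) normc ((sval t).2 y y').
have [||N hN] := @weak_null_norm_null R X T (fun t => (sval t).1.1) c M _ _ e e0.
- move=> [[[n Z] q] /= v] F; rewrite /c /M /=.
  apply: le_trans (_ : \sum_(x <- F) \sum_(y <- Z) \sum_(y' <- Z)
      normc (q y y') * (normc (u x y) * normc (u (g * x)%g y')) <= _).
    apply: ler_sum => x _; apply: le_trans (normc_sum _ _ _) _; apply: ler_sum => y _.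
    apply: le_trans (normc_sum _ _ _) _; apply: ler_sum => y' _.
    by rewrite !normcM normc_conj.
  rewrite exchange_big; apply: ler_sum => y _; rewrite exchange_big; apply: ler_sum => y' _ /=.
  by rewrite -mulr_sumr ler_piMr ?normc_ge0 ?col_pair_mass_le.
- move=> f f1 e' e'0; have [K Ka Ks] := u_approx g f1.
  have [N hN] := conv K Ka e' e'0; exists N.
  move=> [[[n Z] q] /= v] Nn.
  exists (\sum_(y <- Z) \sum_(y' <- Z) q y y' * K y y'); last exact: (hN n Z q Nn v).
  have := has_sum_big Z (fun y => has_sum_big Z (fun y' => has_sumZ (q y y') (Ks y y'))).
  apply: has_sum_ext => x; rewrite /c /= mulr_sumr; apply: eq_bigr => y _.
  by rewrite mulr_sumr; apply: eq_bigr => y' _; rewrite mulrCA.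
- by exists N => n Z q Nn v F; exact: (hN (exist _ (n, Z, q) v) Nn F).
Qed.

(** The tests are [w] times the indicator of [y']. Once [n] exceeds the propagation of an
    approximant, they do not see it, and only the approximation error remains. *)
Lemma far_sum_small g (e : R) : 0 < e -> exists n, forall y' (w : Y -> R[i]) (Z : {fset Y}),
  (forall y, w y != 0 -> (n < lY (y * y'^-1)%g)%N) -> \sum_(y <- Z) normc (w y) ^+ 2 <= 1 ->
  forall F : {fset X},
  \sum_(x <- F) normc (\sum_(y <- Z) w y * u x y) * normc (u (g * x)%g y') <= e.
Proof.
move=> e0.
pose valid n (Z : {fset Y}) (q : Y -> Y -> R[i]) := exists y' (w : Y -> R[i]),
  [/\ y' \in Z, forall y, w y != 0 -> (n < lY (y * y'^-1)%g)%N,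
      \sum_(y <- Z) normc (w y) ^+ 2 <= 1 & q = fun y y'' => w y * (y'' == y')%:R].
have sumq (Z : {fset Y}) y' w (D : Y -> Y -> R[i]) : y' \in Z ->
   \sum_(y <- Z) \sum_(y'' <- Z) w y * (y'' == y')%:R * D y y'' = \sum_(y <- Z) w y * D y y'.
  move=> yZ; apply: eq_bigr => y _; rewrite (sum_fset_single (i0 := y')) //.
    by rewrite eqxx mulr1.
  by move=> i /negPf ->; rewrite mulr0 mul0r.
have [|N hN] := @uniform_tests g valid _ e e0.
  (* The form is evaluated at [w] and at the indicator of [y'], both of squared norm at most 1,
     hence the precision e'/2. *)
  move=> K Ka e' e'0; have [r [M [S [S0 _ KS]]]] := Ka (e' / 2) (divr_gt0 e'0 (ltr0Sn R 1)).
  exists r => n Z q rn [y' [w [yZ wfar w1 ->]]]; rewrite sumq //.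
  have := KS (fun y => (y == y')%:R) w Z.
  rewrite (_ : \sum_(y <- Z) \sum_(y'' <- Z) _ = \sum_(y <- Z) w y * K y y'); last first.
    rewrite -(sumq _ _ _ _ yZ); apply: eq_bigr => y _; apply: eq_bigr => y'' _.
    have [->|ne] := eqVneq y'' y'; last by rewrite !(mulr0, mul0r).
    rewrite !mulr1 mulrC; have [->|wy] := eqVneq (w y) 0; first by rewrite !mul0r.
    by rewrite S0 ?subr0 // (leq_ltn_trans rn) ?wfar.
  move=> /le_trans; apply.
  rewrite (sum_fset_single (i0 := y')) //; last first.
    by move=> i /negPf ->; rewrite normc0 expr0n.
  by rewrite eqxx normc1 expr1n; move: w1; nra.
exists N => y' w Z wfar w1 F.
(* A valid test needs [y'] in its finite set; adding it to [Z] changes no sum because [w] vanishes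
   there. *)
have wy' : w y' = 0.
  apply/eqP; apply: contraT => /wfar; by rewrite mulgV len1 ltn0.
have ZE (V : nmodType) (h : Y -> V) : h y' = 0 -> \sum_(y <- y' |` Z) h y = \sum_(y <- Z) h y.
  move=> h0; have [yZ|yZ] := boolP (y' \in Z).
    by rewrite (_ : y' |` Z = Z) //; apply/fsetUidPr; rewrite fsub1set.
  by rewrite big_fsetU1 //= h0 add0r.
have := hN N (y' |` Z) _ (leqnn _) (ex_intro _ y' (ex_intro _ w _)).
move=> /(_ (fun y y'' => w y * (y'' == y')%:R)) /(_ _ F) h.
apply: le_trans (h _); last first.
  by split => //; rewrite ?inE ?eqxx // ZE // wy' normc0 expr0n.
apply: ler_sum => x _; rewrite sumq ?inE ?eqxx // ZE ?wy' ?mul0r //.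
rewrite -(normc_conj (u (g * x)%g y')) -normcM mulr_suml le_eqVlt; apply/orP; left.
by apply/eqP; congr normc; apply: eq_bigr => y _; rewrite mulrA.
Qed.

(** The product of the two moduli is at least [d], whereas [far_sum_small], tested on the indicator
    of [y], would bound it by d/2 for distant [y] and [y']. *)
Lemma coarse_translate g (d : R) : 0 < d -> exists n, forall x y y',
  d <= m x y -> d <= m (g * x)%g y' -> (lY (y * y'^-1)%g <= n)%N.
Proof.
move=> d0; have [n hn] := far_sum_small g (divr_gt0 d0 (ltr0Sn R 1)).
exists n => x y y' h1 h2; rewrite leqNgt; apply/negP => far.
have := hn y' (fun z => (z == y)%:R) [fset y] _ _ [fset x].
rewrite !big_seq_fset1 eqxx mul1r normc1 expr1n lexx => /(_ _ isT) h.
have {h} : normc (u x y) * normc (u (g * x)%g y') <= d / 2.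
  by apply: h => z; have [->|_] := eqVneq z y; rewrite // eqxx.
have := normc_ge0 (u x y); have := normc_ge0 (u (g * x)%g y').
move: h1 h2; set a := normc _; set b := normc (u (g * x)%g y').
move=> ha hb b0 a0 ab; have : d * d <= (a * b) ^+ 2.
  by rewrite exprMn; apply: ler_pM => //; exact: ltW.
have : (a * b) ^+ 2 <= (d / 2) ^+ 2.
  have d2 : 0 <= d / 2 by lra.
  by rewrite ler_sqr // nnegrE mulr_ge0.
by nra.
Qed.

(** A choice of signs replaces the sum of squares by the squared norm of a single vector [W]. By
    duality this norm is a value of the form in [far_sum_small] with trivial translation, which is
    at most the square root of [e]. *)
Lemma far_mass_small (e : R) : 0 < e -> exists n, forall y' (F : {fset X}) (Z : {fset Y}),
  (forall y, y \in Z -> (n < lY (y * y'^-1)%g)%N) ->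
  \sum_(x <- F) m x y' * (\sum_(y <- Z) m x y) <= e.
Proof.
move=> e0; have se0 : 0 < Num.sqrt e by rewrite sqrtr_gt0.
have [n hn] := far_sum_small 1%g se0; exists n => y' F Z Zfar.
have [f [f1]] := exists_signs Z (fun x y => u x y' * u x y) (fset_uniq F).
rewrite (eq_bigr (fun x => m x y' * \sum_(y <- Z) m x y)); last first.
  by move=> x _; rewrite mulr_sumr; apply: eq_bigr => y _; rewrite normcM exprMn.
move=> /le_trans; apply.
pose W y := \sum_(x <- F) f x * (u x y' * u x y).
rewrite -/(W _); set W2 := \sum_(y <- Z) _.
have W20 : 0 <= W2 by apply: sumr_ge0 => y _; exact: sqr_ge0.
have [->|W2n] := eqVneq W2 0; first exact: ltW.
pose s := Num.sqrt W2; have s0 : 0 < s by rewrite sqrtr_gt0 lt_def W2n.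
have sE : s ^+ 2 = W2 by rewrite sqr_sqrtr.
suff : s <= Num.sqrt e by rewrite ler_sqrt // ltW.
(* The unit vector on which [W] attains its norm over [Z]. *)
pose w y : R[i] := if y \in Z then conjc (W y) / (s%:C)%C else 0.
have sC : (s%:C)%C != 0 :> R[i] by rewrite eq_complex /= eqxx andbT gt_eqF.
have wfar y : w y != 0 -> (n < lY (y * y'^-1)%g)%N.
  by rewrite /w; case: ifP => [/Zfar //|_]; rewrite eqxx.
have w1 : \sum_(y <- Z) normc (w y) ^+ 2 <= 1.
  rewrite big_seq (eq_bigr (fun y => normc (W y) ^+ 2 / s ^+ 2)); last first.
    by move=> y yZ; rewrite /w yZ normcM normc_conj normcV normc_real gtr0_norm // exprMn exprVn.
  by rewrite -big_seq -mulr_suml -/W2 sE divff.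
apply: le_trans (hn y' w Z wfar w1 F).
rewrite (_ : s = normc (\sum_(y <- Z) w y * W y)); last first.
  rewrite big_seq (eq_bigr (fun y => ((normc (W y) ^+ 2 / s)%:C)%C)); last first.
    move=> y yZ; rewrite /w yZ mulrAC [_ * W y]mulrC mulc_conj [in RHS]rmorphM /=.
    by congr (_ * _); rewrite -fmorphV.
  rewrite -big_seq -realc_sum normc_real -mulr_suml -/W2 -sE expr2 mulfK ?gt_eqF //.
  by rewrite gtr0_norm.
rewrite (_ : \sum_(y <- Z) _ = \sum_(x <- F) f x * (\sum_(y <- Z) w y * u x y) * u x y').
  apply: le_trans (normc_sum _ _ _) _; apply: ler_sum => x _; rewrite mul1g !normcM.
  by rewrite ler_wpM2r ?normc_ge0 // ler_piMl ?normc_ge0.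
under eq_bigr do rewrite mulr_sumr; rewrite exchange_big /=; apply: eq_bigr => x _.
rewrite mulr_sumr mulr_suml; apply: eq_bigr => y _; ring.
Qed.

Lemma mass_tail (d e : R) : 0 < d -> 0 < e -> exists n, forall x y' (Z : {fset Y}),
  d <= m x y' -> (forall y, y \in Z -> (n < lY (y * y'^-1)%g)%N) ->
  \sum_(y <- Z) m x y <= e.
Proof.
move=> d0 e0; have [n hn] := far_mass_small (mulr_gt0 d0 e0).
exists n => x y' Z dm /hn-/(_ [fset x]); rewrite big_seq_fset1 => h.
rewrite -(ler_pM2l d0); apply: le_trans h.
by rewrite ler_wpM2r // sumr_ge0 // => y _; exact: sqr_ge0.
Qed.

Lemma in_translate (Z : {fset Y}) (y y' : Y) :
  (y \in [fset (b * y')%g | b in Z]) = ((y * y'^-1)%g \in Z).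
Proof.
apply/imfsetP/idP => [[b /= bZ ->]|yZ]; first by rewrite mulgK.
by exists (y * y'^-1)%g => //; rewrite mulgVK.
Qed.

(** If the entries of column [y'] were all below [d], the average for [m(-, y')] of the row mass in
    the ball around [y'] would be at most [d * N <= 1/4]. The mass outside adds at most 1/4, but
    finitely many rows already give 9/16. The constant is uniform because balls with different
    centres have equal size. *)
Lemma large_entry : exists2 d : R, 0 < d & forall y, exists x, d <= m x y.
Proof.
have q0 : 0 < 1 / 4 :> R by rewrite divr_gt0.
have [n hn] := far_mass_small q0.
pose N := #|` length_ball lY n|; pose d : R := 1 / (4 * N.+1%:R).
have d0 : 0 < d by rewrite divr_gt0 // mulr_gt0.
exists d => // y'; apply: contrapT => /forallNP small.
have {}small x : m x y' <= d by apply/ltW; rewrite ltNge; apply/negP/small.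
have [F hF] := col_mass_ge y' q0.
have [Z hZ] : exists Z : {fset Y}, forall x, x \in F -> 3 / 4 <= \sum_(y <- Z) m x y.
  elim/finSet_rect: (F) => E IH; have [->|[x xE]] := fset_0Vmem E; first by exists fset0.
  have [|Z hZ] := IH (E `\ x); first by rewrite fproperD1.
  have [Z' hZ'] := row_mass_ge u_rows x q0.
  have m0 x' y : 0 <= m x' y by exact: sqr_ge0.
  exists (Z `|` Z') => x' x'E; have [->|ne] := eqVneq x' x.
    have := sum_fset_le (m0 x) (fsubsetUr Z Z'); move: hZ'; lra.
  have /hZ : x' \in E `\ x by rewrite !inE ne.
  by move=> /le_trans; apply; exact: (sum_fset_le (m0 x') (fsubsetUl Z Z')).
pose B := [fset (b * y')%g | b in length_ball lY n].
have far y : y \in Z `\` B -> (n < lY (y * y'^-1)%g)%N.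
  by rewrite inE in_translate in_length_ball -ltnNge => /andP[].
have := hn y' F (Z `\` B) far.
have near : \sum_(x <- F) m x y' * \sum_(y <- B) m x y <= 1 / 4.
  apply: le_trans (_ : d * N%:R <= _); last first.
    have : d * (4 * N.+1%:R) = 1 by rewrite /d divfK // gt_eqF // mulr_gt0.
    by rewrite -[N.+1%:R]natr1; move: d0; lra.
  apply: le_trans (_ : \sum_(x <- F) d * \sum_(y <- B) m x y <= _).
    apply: ler_sum => x _; rewrite ler_wpM2r // sumr_ge0 // => y _; exact: sqr_ge0.
  rewrite -mulr_sumr ler_pM2l // exchange_big /=.
  apply: le_trans (_ : \sum_(y <- B) 1 <= _); first by apply: ler_sum => y _; exact: col_mass_le.
  by rewrite big_const_seq count_predT iter_addr addr0 ler_nat; exact: leq_imfset_card.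
have : 9 / 16 <= \sum_(x <- F) m x y' * \sum_(y <- B `|` Z) m x y.
  apply: le_trans (_ : \sum_(x <- F) m x y' * (3 / 4) <= _).
    by rewrite -mulr_suml; move: hF; lra.
  rewrite big_seq [leRHS]big_seq; apply: ler_sum => x /hZ h.
  rewrite ler_wpM2l ?sqr_ge0 //; apply: le_trans h _.
  by apply: sum_fset_le (fsubsetUr _ _) => y; exact: sqr_ge0.
have -> : \sum_(x <- F) m x y' * \sum_(y <- B `|` Z) m x y =
   \sum_(x <- F) m x y' * \sum_(y <- B) m x y +
   \sum_(x <- F) m x y' * \sum_(y <- Z `\` B) m x y.
  rewrite -big_split; apply: eq_bigr => x _ /=; rewrite -mulrDr; congr (_ * _).
  by rewrite (sum_fsetD _ (fsubsetUl B Z)) fsetDUl fsetDv fset0U.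
move: near; lra.
Qed.

End Half.

(** * Foelner averaging *)

Lemma sum_indicator_le (R : realType) (I J : choiceType) (h : I -> J)
    (Z : {fset I}) (B : {fset J}) :
  injective h -> \sum_(z <- Z) (h z \in B)%:R <= #|` B|%:R :> R.
Proof.
move=> hI; pose E := [fset z | z in Z & h z \in B].
have -> : \sum_(z <- Z) (h z \in B)%:R = #|` [fset h z | z in E]|%:R :> R.
  rewrite card_imfset //= card_fset_sum1 natr_sum -big_fset_condE [RHS]big_mkcond.
by apply: eq_bigr => z _; case: (h z \in B).
rewrite ler_nat; apply: fsubset_leq_card; apply/fsubsetP => j.
by case/imfsetP => z /=; rewrite !inE => /andP[_ zB] ->.
Qed.

Section Folner.
Variables (R : realType) (Y : groupType) (lY : proper_length Y).
Implicit Types (F Z : {fset Y}) (w : Y -> R[i]).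

Definition thicken (n : nat) F : {fset Y} := [fset (b * a)%g | b in length_ball lY n, a in F].

Lemma in_thicken n F y a : a \in F -> (lY (y * a^-1)%g <= n)%N -> y \in thicken n F.
Proof.
move=> aF l; apply/imfset2P; exists (y * a^-1)%g; first by rewrite /= in_length_ball.
by exists a => //; rewrite mulgVK.
Qed.

Lemma thickenP n F y : y \in thicken n F -> exists2 a, a \in F & (lY (y * a^-1)%g <= n)%N.
Proof.
by case/imfset2P => b /=; rewrite in_length_ball => lb [a aF ->]; exists a; rewrite ?mulgK.
Qed.

Lemma sub_thicken n F : F `<=` thicken n F.
Proof. by apply/fsubsetP => y yF; apply: (in_thicken yF); rewrite mulgV len1. Qed.

Definition windows F Z : {fset Y} := [fset (y^-1 * a)%g | y in Z, a in F].

(* [(1 / #|F|) * \sum_g 1_E_g(y) 1_E_g(y')] for the windows [E_g = [set y | y * g \in F]];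
   only finitely many [g] matter for [y, y'] in [Z]. *)
Definition folner_kernel F Z (y y' : Y) : R :=
  (\sum_(g <- windows F Z) ((y * g)%g \in F)%:R * ((y' * g)%g \in F)%:R) / #|` F|%:R.

(** The map sending [g] to [y * g] matches the windows through [y] with the points of [F]. *)
Lemma sum_windows F Z y (phi : Y -> R) : y \in Z ->
  \sum_(g <- windows F Z) ((y * g)%g \in F)%:R * phi (y * g)%g = \sum_(a <- F) phi a.
Proof.
move=> yZ; pose E := [fset (y^-1 * a)%g | a in F].
transitivity (\sum_(g <- E) ((y * g)%g \in F)%:R * phi (y * g)%g).
  apply/esym/big_fset_incl.
    by apply/fsubsetP => g /imfsetP[a /= aF ->]; apply/imfset2P; exists y => //; exists a.
  move=> g _ gE; case: (boolP ((y * g)%g \in F)) => [yg|]; last by rewrite mul0r.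
  by case/negP: gE; apply/imfsetP; exists (y * g)%g => //; rewrite mulKg.
rewrite big_imfset /=; last by move=> a b _ _ /mulgI.
by rewrite big_seq [RHS]big_seq; apply: eq_bigr => a aF; rewrite mulVKg aF mul1r.
Qed.

Lemma folner_defect F Z y y' : F != fset0 -> y \in Z ->
  1 - folner_kernel F Z y y' = (\sum_(a <- F) ((y' * y^-1 * a)%g \notin F)%:R) / #|` F|%:R.
Proof.
move=> F0 yZ; have cF : (#|` F|%:R : R) != 0 by rewrite pnatr_eq0 cardfs_eq0.
rewrite -[X in X - _](divff cF) -mulrBl; congr (_ / _).
have := sum_windows F (fun _ => 1) yZ.
rewrite [RHS]big_const_seq count_predT iter_addr addr0 => <-.
rewrite -sumrB.
have /= <- := sum_windows F (fun a => ((y' * y^-1 * a)%g \notin F)%:R) yZ.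
apply: eq_bigr => g _.
rewrite -mulrBr -mulgA mulKg; congr (_ * _).
by case: (_ \in F); rewrite ?subrr ?subr0.
Qed.

Lemma folner_defect_ge0 F Z y y' : F != fset0 -> y \in Z -> 0 <= 1 - folner_kernel F Z y y'.
Proof. by move=> F0 yZ; rewrite folner_defect // divr_ge0 // sumr_ge0. Qed.

(** The defect is the proportion of points of [F] moved out of [F] by [y' * y^-1], and a short
    displacement moves them into the thin shell of [thicken n F] around [F]. *)
Lemma folner_defect_le n (c : R) F Z y y' : F != fset0 -> y \in Z ->
  #|` thicken n F|%:R <= (1 + c) * #|` F|%:R -> (lY (y * y'^-1)%g <= n)%N ->
  1 - folner_kernel F Z y y' <= c.
Proof.
move=> F0 yZ hF l; rewrite folner_defect //.
have cF : 0 < #|` F|%:R :> R by rewrite ltr0n cardfs_gt0.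
rewrite ler_pdivrMr //.
apply: le_trans (_ : #|` thicken n F `\` F|%:R <= _); last first.
  rewrite cardfsDS ?sub_thicken // natrB ?fsubset_leq_card ?sub_thicken //.
  by move: hF; lra.
apply: le_trans (_ : \sum_(a <- F) ((y' * y^-1 * a)%g \in thicken n F `\` F)%:R <= _).
  rewrite big_seq [leRHS]big_seq; apply: ler_sum => a aF; rewrite ler_nat inE.
  rewrite (_ : _ \in thicken n F) ?andbT //; apply: (in_thicken aF).
  by rewrite mulgK -lenV invgM invgK.
by apply: sum_indicator_le => a b /mulgI.
Qed.

Lemma sum_windows_mass F Z (phi : Y -> R) :
  \sum_(g <- windows F Z) \sum_(y <- Z) ((y * g)%g \in F)%:R * phi y
  = #|` F|%:R * \sum_(y <- Z) phi y.
Proof.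
rewrite exchange_big /= mulr_sumr big_seq [RHS]big_seq; apply: eq_bigr => y yZ.
rewrite -mulr_suml; congr (_ * _); have := sum_windows F (fun _ => 1) yZ.
rewrite [RHS]big_const_seq count_predT iter_addr addr0 => <-.
by apply: eq_bigr => g _; rewrite mulr1.
Qed.

(** Entrywise multiplication by the kernel averages the compressions of the form to the windows. *)
Lemma folner_form F Z (D : Y -> Y -> R[i]) w :
  \sum_(y <- Z) \sum_(y' <- Z) ((folner_kernel F Z y y')%:C)%C * (D y y' * (w y * conjc (w y'))) =
  ((#|` F|%:R^-1)%:C)%C * \sum_(g <- windows F Z) \sum_(y <- Z) \sum_(y' <- Z)
    D y y' * (((y * g)%g \in F)%:R * w y * conjc (((y' * g)%g \in F)%:R * w y')).
Proof.
rewrite mulr_sumr [RHS](eq_bigr (fun g => \sum_(y <- Z) \sum_(y' <- Z)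
   ((#|` F|%:R^-1)%:C)%C * (D y y' * (((y * g)%g \in F)%:R * w y *
     conjc (((y' * g)%g \in F)%:R * w y'))))); last first.
  by move=> g _; rewrite mulr_sumr; apply: eq_bigr => y _; rewrite mulr_sumr.
rewrite [RHS]exchange_big; apply: eq_bigr => y _ /=.
rewrite [RHS]exchange_big; apply: eq_bigr => y' _ /=.
rewrite /folner_kernel mulr_suml realc_sum mulr_suml; apply: eq_bigr => g _.
rewrite !rmorphM !rmorph_nat. ring.
Qed.

(** After [ab <= (a^2 + b^2) / 2], each point is counted at most once for every element of the ball
    of radius [r]. *)
Lemma schur_test r Z w :
  \sum_(y <- Z) \sum_(y' <- Z) (lY (y * y'^-1)%g <= r)%:R * (normc (w y) * normc (w y'))
  <= #|` length_ball lY r|%:R * \sum_(y <- Z) normc (w y) ^+ 2.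
Proof.
pose N : R := #|` length_ball lY r|%:R.
have row y : \sum_(y' <- Z) (lY (y * y'^-1)%g <= r)%:R <= N.
  under eq_bigr do rewrite -in_length_ball.
  by apply: sum_indicator_le => a b /mulgI/invg_inj.
apply: le_trans (_ : \sum_(y <- Z) \sum_(y' <- Z)
   ((lY (y * y'^-1)%g <= r)%:R * normc (w y) ^+ 2 / 2
    + (lY (y' * y^-1)%g <= r)%:R * normc (w y') ^+ 2 / 2) <= _).
  apply: ler_sum => y _; apply: ler_sum => y' _.
  rewrite -[(y' * y^-1)%g]invgK invgM invgK lenV -mulrDl -mulrDr -mulrA.
  by rewrite ler_wpM2l // mul_le_half_sqrD.
under eq_bigr do rewrite big_split /=.
rewrite big_split /= [X in _ + X]exchange_big /= -mulr2n.
rewrite -[leLHS]mulr_natr mulr_suml mulr_sumr; apply: ler_sum => y _.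
under eq_bigr do rewrite -mulrA; rewrite -mulr_suml -[leLHS]mulrA divfK ?pnatr_eq0 //.
by rewrite ler_wpM2r ?sqr_ge0.
Qed.

End Folner.

(** * Localization of row projections by Foelner kernels *)

Section FolnerHalf.
Variables (R : realType) (X Y : groupType) (lY : proper_length Y).
Variable u : X -> Y -> R[i].
Hypothesis u_rows : orthonormal_rows u.
Hypothesis u_cols : orthonormal_rows (fun y x => conjc (u x y)).
Hypothesis u_approx : conjugates_approximable lY u.
Hypothesis folner : forall n (c : R), 0 < c -> exists2 F : {fset Y}, F != fset0 &
  #|` thicken lY n F|%:R <= (1 + c) * #|` F|%:R.

Local Notation m x y := (normc (u x y) ^+ 2).
Local Notation mass w Z := (\sum_(y <- Z) normc (w y) ^+ 2).

Lemma normc_indicator (b : bool) (z : R[i]) : normc (b%:R * z) ^+ 2 = b%:R * normc z ^+ 2.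
Proof. by case: b; rewrite ?mul1r // !mul0r normc0 expr0n. Qed.

(** Each point of [Z] lies in exactly [#|F|] windows, so the masses of the pieces of [w] add up to
    [#|F|] times its mass and the average keeps the bound [e]. *)
Lemma folner_form_bound (F Z : {fset Y}) (D : Y -> Y -> R[i]) (e : R) : F != fset0 ->
  (forall w : Y -> R[i],
     normc (\sum_(y <- Z) \sum_(y' <- Z) D y y' * (w y * conjc (w y'))) <= e * mass w Z) ->
  forall w : Y -> R[i], normc (\sum_(y <- Z) \sum_(y' <- Z)
    ((folner_kernel R F Z y y')%:C)%C * (D y y' * (w y * conjc (w y')))) <= e * mass w Z.
Proof.
move=> F0 hD w; have cF : 0 < #|` F|%:R :> R by rewrite ltr0n cardfs_gt0.
rewrite folner_form normcM normc_real ger0_norm ?invr_ge0 // ler_pdivrMl // mulrCA.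
apply: le_trans (normc_sum _ _ _) _.
have -> : #|` F|%:R * mass w Z =
    \sum_(g <- windows F Z) mass (fun y => ((y * g)%g \in F)%:R * w y) Z.
  rewrite -sum_windows_mass; apply: eq_bigr => g _; apply: eq_bigr => y _.
  by rewrite normc_indicator.
by rewrite mulr_sumr; apply: ler_sum => g _; exact: hD.
Qed.

(** For one kernel [K] with approximant [S], write [(1 - k) K = (K - S) - k (K - S) + (1 - k) S].
    The first two terms have small norm, and on the band supporting [S] the defect [1 - k] is small.
    Then [uniform_tests] gives the absolute sum over [x]. *)
Lemma folner_uniform (e : R) : 0 < e -> exists2 F : {fset Y}, F != fset0 &
  forall (Z : {fset Y}) (w : Y -> R[i]) (A : {fset X}),
  \sum_(x <- A) normc (\sum_(y <- Z) \sum_(y' <- Z)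
    ((1 - folner_kernel R F Z y y')%:C)%C * ((u x y * conjc (u x y')) * (w y * conjc (w y'))))
  <= e * mass w Z.
Proof.
move=> e0.
have Fex n : exists F : {fset Y}, F != fset0 /\
    #|` thicken lY n F|%:R <= (1 + n.+1%:R^-1) * #|` F|%:R :> R.
  by have [|F F0 hF] := @folner n n.+1%:R^-1; [rewrite invr_gt0 | exists F].
pose Fn n := projT1 (cid (Fex n)).
have F0 n : Fn n != fset0 := (projT2 (cid (Fex n))).1.
have Fle n := (projT2 (cid (Fex n))).2; rewrite -/(Fn _) in Fle.
pose k n Z y y' := folner_kernel R (Fn n) Z y y'.
(* Division by zero makes the test vanish when [w] does. *)
pose q n (Z : {fset Y}) w (y y' : Y) : R[i] :=
  (((1 - k n Z y y') / mass w Z)%:C)%C * (w y * conjc (w y')).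
pose valid n (Z : {fset Y}) (p : Y -> Y -> R[i]) := exists w, p = q n Z w.
have mass0 (w : Y -> R[i]) (Z : {fset Y}) : 0 <= mass w Z by apply: sumr_ge0 => y _; exact: sqr_ge0.
have qE n (Z : {fset Y}) (w : Y -> R[i]) (D : Y -> Y -> R[i]) :
    \sum_(y <- Z) \sum_(y' <- Z) q n Z w y y' * D y y' =
    (((mass w Z)^-1)%:C)%C * \sum_(y <- Z) \sum_(y' <- Z)
      ((1 - k n Z y y')%:C)%C * (D y y' * (w y * conjc (w y'))).
  rewrite mulr_sumr; apply: eq_bigr => y _; rewrite mulr_sumr; apply: eq_bigr => y' _.
  rewrite /q [((_ / _)%:C)%C]rmorphM /=; ring.
have [|N hN] := @uniform_tests R X Y lY u u_cols u_approx 1%g valid _ e e0; last first.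
  exists (Fn N) => // Z w A; have := hN N Z (q N Z w) (leqnn _) (ex_intro _ w erefl) A.
  have [s0|s0] := eqVneq (mass w Z) 0.
    move=> _; rewrite s0 mulr0 big1 // => x _; apply/eqP; rewrite normc_eq0; apply/eqP.
    rewrite big1_seq // => y /andP[_ yZ]; rewrite (_ : w y = 0); last first.
      apply/eqP; rewrite -normc_eq0 -sqrf_eq0.
      by move/eqP : s0; rewrite psumr_eq0 => [/allP/(_ _ yZ)//|? _]; exact: sqr_ge0.
    by rewrite big1 // => y' _; rewrite mul0r !mulr0.
  have sp : 0 < mass w Z by rewrite lt_def s0 mass0.
  under eq_bigr => x _ do rewrite mul1g qE normcM normc_real ger0_norm ?invr_ge0 //.
  by rewrite -mulr_sumr ler_pdivrMl // mulrC.
(* Both vectors of the form have the mass of [w], so precision e'/16 gives e'/8; two such terms and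
   e'/2 for the band stay below e'. *)
move=> K Ka e' e'0; have e16 : 0 < e' / 16 by rewrite divr_gt0.
have [r [M [S [S0 SM KS]]]] := Ka _ e16.
have M0 : 0 <= M by apply: le_trans (SM 1%g 1%g); exact: normc_ge0.
pose C := M * #|` length_ball lY r|%:R; have C0 : 0 <= C by rewrite mulr_ge0.
(* Taking [n >= r] makes the defect at most [1 / (n + 1)] on the band of [S]; the other bound gives
   [C / (n + 1) <= e' / 2]. *)
pose N := maxn r (Num.bound (2 * C / e')).
exists N => n Z p Nn [w ->]; rewrite qE.
have [->|s0] := eqVneq (mass w Z) 0; first by rewrite invr0 mul0r normc0 ltW.
have sp : 0 < mass w Z by rewrite lt_def s0 mass0.
rewrite normcM normc_real ger0_norm ?invr_ge0 // ler_pdivrMl //.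
have hD (w' : Y -> R[i]) :
    normc (\sum_(y <- Z) \sum_(y' <- Z) (K y y' - S y y') * (w' y * conjc (w' y')))
    <= e' / 8 * mass w' Z.
  have := KS (fun y => conjc (w' y)) w' Z.
  rewrite (eq_bigr (fun y => normc (w' y) ^+ 2)); last by move=> y _; rewrite normc_conj.
  rewrite (_ : e' / 16 * _ = e' / 8 * mass w' Z); last by field.
  apply: le_trans; rewrite le_eqVlt; apply/orP; left; apply/eqP; congr normc.
  by apply: eq_bigr => y _; apply: eq_bigr => y' _; rewrite -mulrA [w' y * _]mulrC.
have h1 := hD w; have h2 := folner_form_bound (F0 n) hD w.
have h3 : normc (\sum_(y <- Z) \sum_(y' <- Z)
    ((1 - k n Z y y')%:C)%C * (S y y' * (w y * conjc (w y')))) <= e' / 2 * mass w Z.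
  apply: le_trans (_ : \sum_(y <- Z) \sum_(y' <- Z) n.+1%:R^-1 * M *
     ((lY (y * y'^-1)%g <= r)%:R * (normc (w y) * normc (w y'))) <= _).
    apply: le_trans (normc_sum _ _ _) _; rewrite big_seq [leRHS]big_seq; apply: ler_sum => y yZ.
    apply: le_trans (normc_sum _ _ _) _; apply: ler_sum => y' _.
    rewrite !normcM normc_conj normc_real ger0_norm ?folner_defect_ge0 //.
    case: leqP => l; last by rewrite S0 // normc0 !(mul0r, mulr0).
    rewrite mul1r mulrA ler_wpM2r ?mulr_ge0 ?normc_ge0 //.
    apply: ler_pM; rewrite ?normc_ge0 ?folner_defect_ge0 ?SM //.
    apply: (folner_defect_le (F0 n) yZ (Fle n)).
    by apply: leq_trans l _; apply: leq_trans Nn; rewrite leq_max leqnn.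
  under eq_bigr do rewrite -mulr_sumr.
  rewrite -mulr_sumr.
  apply: le_trans (_ : n.+1%:R^-1 * M * (#|` length_ball lY r|%:R * mass w Z) <= _).
    by rewrite ler_wpM2l ?schur_test ?mulr_ge0 ?invr_ge0.
  rewrite -mulrA [M * _]mulrA -/C mulrA ler_wpM2r // ler_pdivrMl //.
  have : 2 * C / e' < (Num.bound (2 * C / e'))%:R.
    by apply: archi_boundP; rewrite divr_ge0 ?(ltW e'0) // mulr_ge0.
  rewrite ltr_pdivrMr // => hb; have : (Num.bound (2 * C / e'))%:R <= n.+1%:R :> R.
    by rewrite ler_nat ltnW // ltnS; apply: leq_trans Nn; rewrite leq_max leqnn orbT.
  by move: e'0 hb; nra.
have -> : \sum_(y <- Z) \sum_(y' <- Z) ((1 - k n Z y y')%:C)%C * (K y y' * (w y * conjc (w y'))) =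
    \sum_(y <- Z) \sum_(y' <- Z) (K y y' - S y y') * (w y * conjc (w y'))
  - \sum_(y <- Z) \sum_(y' <- Z) ((k n Z y y')%:C)%C * ((K y y' - S y y') * (w y * conjc (w y')))
  + \sum_(y <- Z) \sum_(y' <- Z) ((1 - k n Z y y')%:C)%C * (S y y' * (w y * conjc (w y'))).
  rewrite -sumrB -big_split; apply: eq_bigr => y _; rewrite -sumrB -big_split.
  by apply: eq_bigr => y' _ /=; rewrite rmorphB rmorph1 /=; ring.
apply: le_trans (le_normcD _ _) _; apply: le_trans (lerD (le_normcD _ _) h3) _.
by rewrite normcN; move: h1 h2 sp e'0; rewrite /k; nra.
Qed.

(** The square is split by [1 = (1 - k) + k]. The part with [1 - k] is at most a quarter of the mass
    by [folner_uniform]. The other is an average over windows; Cauchy-Schwarz on a window leaves a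
    sum of column masses over at most [#|F|] points, each at most [1 / (4 #|F|)]. *)
Lemma folner_bessel : exists2 e' : R, 0 < e' & forall (A : {fset X}) (Z : {fset Y}),
  (forall y, y \in Z -> \sum_(x <- A) m x y <= e') ->
  forall w : Y -> R[i],
  \sum_(x <- A) normc (\sum_(y <- Z) w y * u x y) ^+ 2 <= 1 / 2 * mass w Z.
Proof.
have q0 : 0 < 1 / 4 :> R by rewrite divr_gt0.
have [F F0 hF] := folner_uniform q0.
have cF : 0 < #|` F|%:R :> R by rewrite ltr0n cardfs_gt0.
exists (1 / (4 * #|` F|%:R)); first by rewrite divr_gt0 // mulr_gt0.
move=> A Z small w.
have sqE (v : Y -> R[i]) x : ((normc (\sum_(y <- Z) v y * u x y) ^+ 2)%:C)%C =
    \sum_(y <- Z) \sum_(y' <- Z) (u x y * conjc (u x y')) * (v y * conjc (v y')).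
  rewrite -mulc_conj conjc_sum mulr_suml; apply: eq_bigr => y _; rewrite mulr_sumr.
  by apply: eq_bigr => y' _; rewrite rmorphM /=; ring.
apply: le_trans (_ : 1 / 4 * mass w Z + 1 / 4 * mass w Z <= _); last by lra.
apply: le_trans (lerD (hF Z w A) (lexx _)); rewrite -lerBlDl -sumrB.
apply: le_trans (_ : \sum_(x <- A) #|` F|%:R^-1 * \sum_(g <- windows F Z)
   (\sum_(y <- Z) ((y * g)%g \in F)%:R * normc (w y) ^+ 2) *
   (\sum_(y <- Z) ((y * g)%g \in F)%:R * m x y) <= _).
  apply: ler_sum => x _; rewrite lerBlDl.
  have -> : normc (\sum_(y <- Z) w y * u x y) ^+ 2 =
      normc (((normc (\sum_(y <- Z) w y * u x y) ^+ 2)%:C)%C : R[i]).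
    by rewrite normc_real ger0_norm ?sqr_ge0.
  rewrite sqE; set D := fun y y' => u x y * conjc (u x y').
  rewrite (_ : \sum_(y <- Z) \sum_(y' <- Z) _ =
    \sum_(y <- Z) \sum_(y' <- Z)
      ((1 - folner_kernel R F Z y y')%:C)%C * (D y y' * (w y * conjc (w y')))
    + \sum_(y <- Z) \sum_(y' <- Z)
      ((folner_kernel R F Z y y')%:C)%C * (D y y' * (w y * conjc (w y')))); last first.
    rewrite -big_split; apply: eq_bigr => y _; rewrite -big_split; apply: eq_bigr => y' _ /=.
    by rewrite rmorphB rmorph1 /D /=; ring.
  apply: le_trans (le_normcD _ _) _; rewrite lerD2l folner_form normcM normc_real.
  rewrite ger0_norm ?invr_ge0 // ler_wpM2l ?invr_ge0 //.
  apply: le_trans (normc_sum _ _ _) _; apply: ler_sum => g _.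
  rewrite -(sqE (fun y => ((y * g)%g \in F)%:R * w y)) normc_real ger0_norm ?sqr_ge0 //.
  have ind (v : Y -> R[i]) : \sum_(y <- Z) ((y * g)%g \in F)%:R * normc (v y) ^+ 2 =
      mass (fun y => ((y * g)%g \in F)%:R * v y) Z.
    by apply: eq_bigr => y _; rewrite normc_indicator.
  rewrite !ind; apply: le_trans (cauchy_schwarz _ _ _).
  rewrite le_eqVlt; apply/orP; left; apply/eqP; congr (normc _ ^+ 2).
  by apply: eq_bigr => y _; case: (_ \in F); rewrite ?mul1r // !mul0r.
rewrite -mulr_sumr ler_pdivrMl // exchange_big /=.
apply: le_trans (_ : \sum_(g <- windows F Z)
   (\sum_(y <- Z) ((y * g)%g \in F)%:R * normc (w y) ^+ 2) * (1 / 4) <= _); last first.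
  by rewrite -mulr_suml sum_windows_mass mulrC mulrCA.
apply: ler_sum => g _; rewrite -mulr_sumr ler_wpM2l //.
  by apply: sumr_ge0 => y _; rewrite mulr_ge0 // sqr_ge0.
rewrite exchange_big /=.
apply: le_trans (_ : \sum_(y <- Z) ((y * g)%g \in F)%:R * (1 / (4 * #|` F|%:R)) <= _).
  rewrite big_seq [leRHS]big_seq; apply: ler_sum => y yZ.
  by rewrite -mulr_sumr ler_wpM2l // small.
rewrite -mulr_suml; apply: le_trans (_ : #|` F|%:R * (1 / (4 * #|` F|%:R)) <= _).
  rewrite ler_wpM2r ?divr_ge0 ?mulr_ge0 //.
  by apply: (sum_indicator_le _ _ (h := fun y => (y * g)%g)) => a b /mulIg.
by rewrite le_eqVlt; apply/orP; left; apply/eqP; field; rewrite gt_eqF.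
Qed.

End FolnerHalf.

(** * From the unitary to a bijection *)

(** With more rows than columns the submatrix on [A] and [B] has a nonzero left kernel vector,
    extended by zero. *)
Lemma exists_relation (K : fieldType) (X Y : choiceType) (u : X -> Y -> K)
    (A : {fset X}) (B : {fset Y}) : (#|` B| < #|` A|)%N ->
  exists a : X -> K, (exists2 x, x \in A & a x != 0) /\
    forall y, y \in B -> \sum_(x <- A) a x * u x y = 0.
Proof.
move=> BA; have A0 : (0 < #|` A|)%N by exact: leq_ltn_trans BA.
have [x0 x0A] : exists x0, x0 \in A by apply/fset0Pn; rewrite -cardfs_gt0.
pose ax (i : 'I_#|` A|) := nth x0 A i.
pose M := \matrix_(i < #|` A|, j < #|` B|) u (ax i) (tnth (in_tuple B) j).
have : kermx M != 0.
  rewrite kermx_eq0 /row_free; apply/negP => /eqP rk.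
  by have := rank_leq_col M; rewrite rk leqNgt BA.
case/rowV0Pn => v /sub_kermxP vM v0.
pose a x : K := if insub (index x A) is Some i then v 0 i else 0.
have aE i : a (ax i) = v 0 i.
  rewrite /a /ax index_uniq ?fset_uniq //.
  by case: insubP => [j _ ji|]; [congr (v 0 _); exact: val_inj | rewrite ltn_ord].
have sumE (h : X -> K) : \sum_(x <- A) h x = \sum_(i < #|` A|) h (ax i).
  by rewrite (big_nth x0) big_mkord.
exists a; split.
  have /rV0Pn[i vi] := v0; exists (ax i); last by rewrite aE.
  by rewrite mem_nth.
move=> y yB; have jB : (index y B < #|` B|)%N by rewrite index_mem.
have := congr1 (fun N : 'rV_#|` B| => N 0 (Ordinal jB)) vM; rewrite !mxE => h.
rewrite sumE -[RHS]h; apply: eq_bigr => i _; rewrite aE mxE; congr (_ * u _ _).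
by rewrite (tnth_nth y) /= nth_index.
Qed.

Section Injection.
Variables (R : realType) (X Y : groupType) (lX : proper_length X) (lY : proper_length Y).
Variable u : X -> Y -> R[i].
Hypothesis u_rows : orthonormal_rows u.
Hypothesis u_cols : orthonormal_rows (fun y x => conjc (u x y)).
Hypothesis u_approx : conjugates_approximable lY u.
Hypothesis u_approx' : conjugates_approximable lX (fun y x => conjc (u x y)).

Local Notation m x y := (normc (u x y) ^+ 2).

Lemma orthonormal_rows_conjK : orthonormal_rows (fun x y => conjc (conjc (u x y))).
Proof.
rewrite (_ : (fun x y => _) = u) //.
by apply/funext => x; apply/funext => y; rewrite conjcK.
Qed.

(** The maximum of the bounds of [coarse_translate] over the finitely many displacements of length
    at most [r]. *)
Lemma coarse_pair (d : R) r : 0 < d -> exists n, forall x x' y y',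
  (lX (x' * x^-1)%g <= r)%N -> d <= m x y -> d <= m x' y' -> (lY (y * y'^-1)%g <= n)%N.
Proof.
move=> d0; have cex g := coarse_translate u_cols u_approx g d0.
pose nf g := projT1 (cid (cex g)).
exists (\max_(g <- length_ball lX r) nf g)%N => x x' y y' l h h'.
have := projT2 (cid (cex (x' * x^-1)%g)) x y y' h; rewrite mulgVK => /(_ h')/leq_trans.
apply; apply: (@leq_bigmax_seq _ _ _ nf) => //; by rewrite in_length_ball.
Qed.

Lemma mass_near (d e : R) : 0 < d -> 0 < e -> exists n, forall x y' (B : {fset Y}),
  d <= m x y' -> (forall y, (lY (y * y'^-1)%g <= n)%N -> y \in B) ->
  1 - e <= \sum_(y <- B) m x y.
Proof.
move=> d0 e0; have e2 : 0 < e / 2 by rewrite divr_gt0.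
have [n hn] := mass_tail u_cols u_approx d0 e2.
exists n => x y' B dm nearB; have [Z hZ] := row_mass_ge u_rows x e2.
have : \sum_(y <- Z `\` B) m x y <= e / 2.
  apply: hn dm _ => y; rewrite inE => /andP[yB _].
  by rewrite ltnNge; apply: contra yB => /nearB.
have : \sum_(y <- Z) m x y <= \sum_(y <- B `|` Z) m x y.
  by apply: sum_fset_le (fsubsetUr _ _) => y; exact: sqr_ge0.
rewrite (sum_fsetD _ (fsubsetUl B Z)) fsetDUl fsetDv fset0U; lra.
Qed.

Section Partner.
Variables (d : R) (psi : X -> Y) (phi : Y -> X).
Hypothesis d0 : 0 < d.
Hypothesis psiP : forall x, d <= m x (psi x).
Hypothesis phiP : forall y, d <= m (phi y) y.

Let nb n x := thicken lY n [fset psi x].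

Let nbP n x y : reflect ((lY (y * (psi x)^-1)%g <= n)%N) (y \in nb n x).
Proof.
apply: (iffP idP) => [/thickenP[a]|]; first by rewrite inE => /eqP ->.
by apply: in_thicken; rewrite inE.
Qed.

Let coverP n (A : {fset X}) y :
  reflect (exists2 x, x \in A & (lY (y * (psi x)^-1)%g <= n)%N) (y \in \bigcup_(x <- A) nb n x).
Proof.
apply: (iffP (bigfcupP _ _ _ _)) => [[x]|[x xA l]].
  by rewrite andbT => xA /nbP; exists x.
by exists x; [rewrite xA | apply/nbP].
Qed.

(** Rows in [A] keep mass at least [1 / (1 + c)] on [B] and columns have mass at most 1, so
    [#|A| <= (1 + c) #|B|]. Expansion bounds this by the size of the [r]-thickening of [B], which
    still consists of points near partners of [A]. *)
Lemma hall_expanding r (c : R) : 0 < c ->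
  (forall F : {fset Y}, F != fset0 -> (1 + c) * #|` F|%:R <= #|` thicken lY r F|%:R) ->
  exists n, hall (nb n).
Proof.
move=> c0 expand; have c1 : 0 < 1 + c by rewrite addr_gt0.
have ce : 0 < c / (1 + c) by rewrite divr_gt0.
have [n hn] := mass_near d0 ce; exists (r + n)%N => A.
have [->|A0] := eqVneq A fset0; first by rewrite cardfs0.
pose B := \bigcup_(x <- A) nb n x.
have AB : #|` A|%:R <= (1 + c) * #|` B|%:R :> R.
  rewrite -ler_pdivrMl //.
  apply: le_trans (_ : \sum_(x <- A) \sum_(y <- B) m x y <= _).
    rewrite card_fset_sum1 natr_sum mulr_sumr big_seq [leRHS]big_seq.
    apply: ler_sum => x xA; rewrite mulr1.
    apply: le_trans (hn x (psi x) B (psiP x) _); last by move=> y l; apply/coverP; exists x.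
    rewrite le_eqVlt; apply/orP; left; apply/eqP; field; exact: lt0r_neq0.
  rewrite exchange_big card_fset_sum1 natr_sum /=; apply: ler_sum => y _.
  exact: col_mass_le u_cols _ _.
have B0 : B != fset0.
  have /fset0Pn[x xA] := A0; apply/fset0Pn; exists (psi x); apply/coverP; exists x => //.
  by rewrite mulgV len1.
have := le_trans AB (expand B B0); rewrite ler_nat => /leq_trans; apply.
apply: fsubset_leq_card; apply/fsubsetP => y /thickenP[b /coverP[x xA l] l'].
apply/coverP; exists x => //.
rewrite -[y](mulgVK b) -mulgA; apply: leq_trans (lenM _ _ _) _; exact: leq_add.
Qed.

(* If Hall's condition fails, some [V] in the span of the rows in [A] vanishes on [B];
   it is fixed by the projection onto this span, against [folner_bessel]. *)
Lemma hall_folner :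
  (forall n (c : R), 0 < c -> exists2 F : {fset Y}, F != fset0 &
     #|` thicken lY n F|%:R <= (1 + c) * #|` F|%:R) ->
  exists n, hall (nb n).
Proof.
move=> folner; have [e' e'0 bessel] := folner_bessel u_cols u_approx folner.
have [n1 hn1] := mass_tail orthonormal_rows_conjK u_approx' d0 e'0.
have [n hn] := coarse_pair n1 d0.
exists n => A; rewrite leqNgt; apply/negP => BA.
set B := \bigcup_(x <- A) _ in BA.
have [a [[x1 x1A ax1] aB]] := exists_relation u BA.
pose V y := \sum_(x <- A) a x * u x y.
pose al := \sum_(x <- A) normc (a x) ^+ 2.
have al0 : 0 < al.
  rewrite /al (big_fsetD1 x1) //= ltr_pwDl //.
    by rewrite exprn_gt0 // lt_def normc_eq0 ax1 normc_ge0.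
  by rewrite sumr_ge0 // => x _; exact: sqr_ge0.
(* Pythagoras for orthonormal rows: [V] has the squared norm of its coefficients. *)
have Vsum : has_sum (fun y => ((normc (V y) ^+ 2)%:C)%C) ((al%:C)%C).
  have h := has_sum_big A (fun x => has_sum_big A (fun x' =>
    has_sumZ (a x * conjc (a x')) (u_rows x x'))).
  have -> : (al%:C)%C = \sum_(x <- A) \sum_(x' <- A) a x * conjc (a x') * (x == x')%:R.
    rewrite realc_sum big_seq [RHS]big_seq; apply: eq_bigr => x xA.
    rewrite (sum_fset_single (i0 := x)) // ?eqxx ?mulr1 ?mulc_conj //.
    by move=> i ix; rewrite eq_sym (negPf ix) mulr0.
  apply: has_sum_ext h => y; rewrite -mulc_conj /V conjc_sum mulr_suml.
  apply: eq_bigr => x _; rewrite mulr_sumr; apply: eq_bigr => x' _.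
  by rewrite rmorphM /=; ring.
(* A row of [A] within [n1] of [phi y] would have its partner within [n] of [y], putting [y] in [B].
   So [A] lies entirely in the tail of column [y]. *)
have far y : y \notin B -> \sum_(x <- A) m x y <= e'.
  move=> yB; under eq_bigr do rewrite -normc_conj.
  apply: (hn1 y (phi y)); first by rewrite normc_conj.
  move=> x xA; rewrite ltnNge; apply: contra yB => l; apply/coverP; exists x => //.
  exact: hn l (phiP y) (psiP x).
have q0 : 0 < al / 4 by rewrite divr_gt0.
have [Z hZ] := has_sum_real_ge q0 Vsum.
pose be := \sum_(y <- Z `\` B) normc (V y) ^+ 2.
have {hZ} be1 : al - al / 4 <= be.
  apply: le_trans hZ _; apply: le_trans (sum_fset_le _ (fsubsetUr B Z)) _.
    by move=> y; exact: sqr_ge0.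
  rewrite (sum_fsetD _ (fsubsetUl B Z)) fsetDUl fsetDv fset0U -/be.
  rewrite big1_seq ?add0r // => y /andP[_ yB]; by rewrite /V aB // normc0 expr0n.
have := bessel A (Z `\` B) _ (fun y => conjc (V y)).
under [X in _ -> _ <= _ * X]eq_bigr do rewrite normc_conj.
rewrite -/be => /(_ _) bes.
have {bes} : \sum_(x <- A) normc (\sum_(y <- Z `\` B) conjc (V y) * u x y) ^+ 2 <= 1 / 2 * be.
  by apply: bes => y; rewrite inE => /andP[yB _]; exact: far.
(* Expanding [V] in the rows writes [be] as the pairing of [a] with the row coefficients of the
   restriction of [V]. *)
have : be ^+ 2 <= al * \sum_(x <- A) normc (\sum_(y <- Z `\` B) conjc (V y) * u x y) ^+ 2.
  apply: le_trans (cauchy_schwarz _ _ _).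
  have -> : be = normc ((be%:C)%C : R[i]).
    by rewrite normc_real ger0_norm // sumr_ge0 // => y _; exact: sqr_ge0.
  rewrite le_eqVlt; apply/orP; left; apply/eqP; congr (normc _ ^+ 2).
  rewrite realc_sum; under [RHS]eq_bigr do rewrite mulr_sumr.
  rewrite exchange_big; apply: eq_bigr => y _ /=; rewrite -mulc_conj /V mulr_suml.
  by apply: eq_bigr => x _; ring.
(* From [be^2 <= al * t] and [t <= be / 2] follows [be <= al / 2], against [be >= 3 al / 4]. *)
set t := \sum_(x <- A) _; move: al0 be1 => + + h1 h2; clearbody al be t; nra.
Qed.

(** Either Foelner sets exist for all parameters, or some radius and constant expand every nonempty
    finite set; both cases give Hall's condition. *)
Lemma close_injection : countable [set: X] ->
  exists2 j : X -> Y, injective j & exists n, forall x y, d <= m x y -> (lY (j x * y^-1)%g <= n)%N.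
Proof.
move=> cX.
have [n hn] : exists n, hall (nb n).
  have [|nf] := pselect (forall n (c : R), 0 < c -> exists2 F : {fset Y}, F != fset0 &
     #|` thicken lY n F|%:R <= (1 + c) * #|` F|%:R); first exact: hall_folner.
  apply: contrapT => nh; apply: nf => r c c0; apply: contrapT => nF.
  apply: nh; apply: (hall_expanding (r := r) c0) => F F0.
  by rewrite leNgt; apply/negP => /ltW hF; apply: nF; exists F.
have [j jI jn] := marriage cX hn; exists j => //.
have [n' hn'] := coarse_pair 0 d0; exists (n + n')%N => x y xy.
rewrite (_ : (j x * y^-1)%g = ((j x * (psi x)^-1) * (psi x * y^-1))%g); last first.
  by rewrite -mulgA mulKg.
apply: leq_trans (lenM _ _ _) _; apply: leq_add; first exact/nbP.
by apply: (hn' x x); rewrite ?mulgV ?len1.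
Qed.

End Partner.

End Injection.

Section Bijection.
Variables (R : realType) (X Y : groupType) (lX : proper_length X) (lY : proper_length Y).
Variable u : X -> Y -> R[i].
Hypothesis u_rows : orthonormal_rows u.
Hypothesis u_cols : orthonormal_rows (fun y x => conjc (u x y)).
Hypothesis u_approx : conjugates_approximable lY u.
Hypothesis u_approx' : conjugates_approximable lX (fun y x => conjc (u x y)).
Hypotheses (countX : countable [set: X]) (countY : countable [set: Y]).

Local Notation m x y := (normc (u x y) ^+ 2).

Definition coarse (X' Y' : groupType) (l : proper_length X') (l' : proper_length Y')
    (h : X' -> Y') : Prop :=
  forall r, exists n, forall x x', (l (x' * x^-1)%g <= r)%N -> (l' (h x' * (h x)^-1)%g <= n)%N.

(** The displacement of [h] factors through points [y], [y'] related to [x], [x']: two bounded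
    errors and one controlled displacement. *)
Lemma coarse_of_close (X' Y' : groupType) (l : proper_length X') (l' : proper_length Y')
    (h : X' -> Y') (rho : X' -> Y' -> Prop) :
  (forall x, exists y, rho x y) ->
  (forall r, exists n, forall x x' y y', (l (x' * x^-1)%g <= r)%N -> rho x y -> rho x' y' ->
     (l' (y * y'^-1)%g <= n)%N) ->
  (exists n, forall x y, rho x y -> (l' (h x * y^-1)%g <= n)%N) ->
  coarse l l' h.
Proof.
move=> tot cp [n hn] r; have [k hk] := cp r; exists (n + (k + n))%N => x x' xx'.
have [y xy] := tot x; have [y' xy'] := tot x'.
rewrite (_ : (h x' * (h x)^-1)%g = ((h x' * y'^-1) * ((y * y'^-1)^-1 * (h x * y^-1)^-1))%g).
  apply: leq_trans (lenM _ _ _) _; apply: leq_add; first exact: hn.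
  by apply: leq_trans (lenM _ _ _) _; rewrite !lenV; apply: leq_add; [exact: hk xy xy'|exact: hn].
by rewrite !invgM !invgK !mulgA mulgVK mulgVK.
Qed.

Lemma coarse_bijection : exists (h : X -> Y) (h' : Y -> X),
  [/\ cancel h h', cancel h' h, coarse lX lY h & coarse lY lX h'].
Proof.
have [d1 d10 hd1] := large_entry u_rows u_cols u_approx.
have [d2 d20] := large_entry u_cols (orthonormal_rows_conjK u_rows) u_approx'.
move=> /(_ _)/cid hd2.
pose d := Num.min d1 d2.
have d0 : 0 < d by rewrite lt_min d10.
pose phi y := projT1 (cid (hd1 y)); pose psi x := projT1 (hd2 x).
have phiP y : d <= m (phi y) y by rewrite ge_min (projT2 (cid (hd1 y))).
have psiP x : d <= m x (psi x).
  by rewrite ge_min; have := projT2 (hd2 x); rewrite normc_conj -/(psi x) => ->; rewrite orbT.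
have [j jI [n1 hj]] := close_injection u_rows u_cols u_approx u_approx' d0 psiP phiP countX.
have u_approxK : conjugates_approximable lY (fun x y => conjc (conjc (u x y))).
  rewrite (_ : (fun x y => _) = u) //.
  by apply/funext => x; apply/funext => y; rewrite conjcK.
have phiP' y : d <= normc (conjc (u (phi y) y)) ^+ 2 by rewrite normc_conj.
have psiP' x : d <= normc (conjc (u x (psi x))) ^+ 2 by rewrite normc_conj.
have [k kI [n2 hk]] := close_injection u_cols (orthonormal_rows_conjK u_rows)
   u_approx' u_approxK d0 phiP' psiP' countY.
have [h [h' [hK h'K hjk]]] := bijection_of_injections jI kI.
have cp r := coarse_pair lX u_cols u_approx r d0.
have cp' r := coarse_pair lY (orthonormal_rows_conjK u_rows) u_approx' r d0.
have [a ha] := cp n2.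
(* Where [k (h x) = x], the partner [phi (h x)] is within [n2] of [x], so [coarse_pair] compares
   [h x] with any [y] related to [x]. *)
have hclose x y : d <= m x y -> (lY (h x * y^-1)%g <= n1 + a)%N.
  move=> xy; case: (hjk x) => [->|kx]; first by apply: leq_trans (hj _ _ xy) (leq_addr _ _).
  apply: leq_trans (leq_addl _ _).
  have := hk (h x) (phi (h x)); rewrite normc_conj kx => /(_ (phiP _)) l.
  exact: ha l (phiP _) xy.
have [b hb] := cp' (n1 + a)%N.
have h'close y x : d <= m x y -> (lX (h' y * x^-1)%g <= b)%N.
  move=> xy; have := hclose (h' y) (psi (h' y)) (psiP _); rewrite h'K => l.
  by apply: (hb _ _ _ _ l); rewrite normc_conj.
exists h, h'; split => //.
- apply: (coarse_of_close (rho := fun x y => d <= m x y)) => //; last by exists (n1 + a)%N.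
  by move=> x; exists (psi x).
- apply: (coarse_of_close (rho := fun y x => d <= m x y)); last by exists b.
    by move=> y; exists (phi y).
  move=> r; have [n hn] := cp' r; exists n => y y' x x' l xy xy'.
  by apply: (hn y y') => //; rewrite normc_conj.
Qed.

End Bijection.

(** * Operators on square-summable families *)

Section L2.
Variables (R : realType) (I : choiceType).
Implicit Types (u v : l2 R I) (F : {fset I}).

Definition nrm u : R := Num.sqrt (fine (sqsum u)).

Lemma normE u : `|u| = ((nrm u)%:C)%C.
Proof. by []. Qed.

Lemma nrm_ge0 u : 0 <= nrm u.
Proof. exact: sqrtr_ge0. Qed.

Lemma fset_sum_le_sqsum (x : I -> R[i]) F :
  ((\sum_(i <- F) normc (x i) ^+ 2)%:E <= sqsum x)%E.
Proof.
rewrite /sqsum; apply: esum_ge; exists [set` F]; first by split.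
by rewrite fsbig_finite //= set_fsetK -sumEFin.
Qed.

Lemma sqsum_le (x : I -> R[i]) (M : R) :
  (forall F, \sum_(i <- F) normc (x i) ^+ 2 <= M) -> (sqsum x <= M%:E)%E.
Proof.
move=> h; apply: ge_ereal_sup => _ [A [finA _] <-].
by rewrite fsbig_finite //= sumEFin lee_fin.
Qed.

Lemma fset_sum_le_nrm u F : \sum_(i <- F) normc (u i) ^+ 2 <= nrm u ^+ 2.
Proof. by have := fset_sum_le_sqsum u F; rewrite l2_norm_sqr lee_fin. Qed.

Lemma nrm_sqr_le u (M : R) : (forall F, \sum_(i <- F) normc (u i) ^+ 2 <= M) -> nrm u ^+ 2 <= M.
Proof. by move=> /sqsum_le; rewrite l2_norm_sqr lee_fin. Qed.

Lemma nrm_le u (k : R) : 0 <= k ->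
  (forall F, \sum_(i <- F) normc (u i) ^+ 2 <= k ^+ 2) -> nrm u <= k.
Proof.
by move=> k0 /nrm_sqr_le; rewrite ler_sqr // nnegrE nrm_ge0.
Qed.

Lemma coord_le_nrm u i : normc (u i) <= nrm u.
Proof.
have := fset_sum_le_nrm u [fset i]; rewrite big_seq_fset1.
by rewrite ler_sqr // nnegrE ?normc_ge0 ?nrm_ge0.
Qed.

Lemma nrm_tail u (e : R) : 0 < e -> exists F, forall F', [disjoint F & F'] ->
  \sum_(i <- F') normc (u i) ^+ 2 <= e.
Proof.
move=> e0; have [F hF] : exists F, nrm u ^+ 2 - e < \sum_(i <- F) normc (u i) ^+ 2.
  apply: contrapT => /forallNP h.
  have : nrm u ^+ 2 <= nrm u ^+ 2 - e.
    by apply: nrm_sqr_le => F; rewrite leNgt; apply/negP.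
  by lra.
exists F => F' dF; have := fset_sum_le_nrm u (F `|` F').
rewrite (sum_fsetD _ (fsubsetUl F F')) fsetDUl fsetDv fset0U.
have -> : F' `\` F = F' by apply/fsetDidPl; rewrite fdisjoint_sym.
by move: hF; lra.
Qed.

Lemma nrmD u v : nrm (u + v) <= nrm u + nrm v.
Proof. by have := l2_normD u v; rewrite /l2_norm -rmorphD lecR. Qed.

Lemma nrmZ c u : nrm (c *: u) = normc c * nrm u.
Proof.
have := l2_normZ c u; rewrite /l2_norm (_ : `|c| = ((normc c)%:C)%C) //.
by rewrite -rmorphM => /complexI.
Qed.

Lemma nrm0 : nrm 0 = 0.
Proof. by rewrite -(scale0r 0) nrmZ normc0 mul0r. Qed.

Lemma nrmB u v : nrm (u - v) = nrm (v - u).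
Proof. by rewrite -opprB -scaleN1r nrmZ normcN normc1 mul1r. Qed.

Lemma nrm_triangle u v w : nrm (u - w) <= nrm (u - v) + nrm (v - w).
Proof. by have := nrmD (u - v) (v - w); rewrite subrKA. Qed.

Lemma l2_addE u v i : (u + v) i = u i + v i. Proof. by []. Qed.
Lemma l2_scaleE c u i : (c *: u) i = c * u i. Proof. by []. Qed.
Lemma l2_subE u v i : (u - v) i = u i - v i. Proof. by []. Qed.

Lemma l2_sumE (J : Type) (r : seq J) (v : J -> l2 R I) i :
  (\sum_(j <- r) v j) i = \sum_(j <- r) v j i.
Proof. by elim: r => [|j r IH]; rewrite ?big_nil // !big_cons l2_addE IH. Qed.

Lemma l2_ext u v : (forall i, u i = v i) -> u = v.
Proof. by move=> uv; apply/val_inj/funext. Qed.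

Fact delta_subproof (p : I) : (fun i => (i == p)%:R) \in @l2_pred R I.
Proof.
apply/l2_predP; apply: (@le_lt_trans _ _ 1%:E); last by rewrite ltry.
apply: sqsum_le => F; have [pF|pF] := boolP (p \in F).
  rewrite (sum_fset_single (i0 := p)) // ?eqxx ?normc1 ?expr1n //.
  by move=> i /negPf ->; rewrite normc0 expr0n.
rewrite big1_seq // => i /andP[_ iF]; case: eqP iF pF => [->->//|_ _ _].
by rewrite normc0 expr0n.
Qed.

Definition delta (p : I) : l2 R I := L2 (delta_subproof p).

Lemma deltaE p i : delta p i = (i == p)%:R. Proof. by []. Qed.

Lemma nrm_combination (v : I -> R[i]) F :
  nrm (\sum_(p <- F) v p *: delta p) ^+ 2 <= \sum_(p <- F) normc (v p) ^+ 2.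
Proof.
apply: nrm_sqr_le => F'.
have n0 i : 0 <= normc (v i) ^+ 2 by exact: sqr_ge0.
apply: le_trans (_ : \sum_(i <- F' `|` F) (i \in F)%:R * normc (v i) ^+ 2 <= _).
  apply: le_trans (sum_fset_le _ (fsubsetUl F' F)); last by move=> i; rewrite mulr_ge0.
  rewrite le_eqVlt; apply/orP; left; apply/eqP; apply: eq_bigr => i _.
  rewrite l2_sumE; have [iF|iF] := boolP (i \in F).
    rewrite (sum_fset_single (i0 := i)) ?l2_scaleE ?deltaE ?eqxx ?mulr1 ?mul1r //.
    by move=> j ji; rewrite l2_scaleE deltaE eq_sym (negPf ji) mulr0.
  rewrite big1_seq ?normc0 ?expr0n ?mul0r // => j /andP[_ jF].
  by rewrite l2_scaleE deltaE; case: eqP jF iF => [->->//|_ _ _]; rewrite mulr0.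
rewrite (sum_fsetD _ (fsubsetUr F' F)) [X in _ + X]big1_seq ?addr0.
  by rewrite big_seq [leRHS]big_seq; apply: ler_sum => i ->; rewrite mul1r.
by move=> i /andP[_]; rewrite inE => /andP[/negPf -> _]; rewrite mul0r.
Qed.

Lemma nrm_delta p : nrm (delta p) <= 1.
Proof.
have := nrm_combination (fun=> 1) [fset p].
rewrite !big_seq_fset1 scale1r normc1 expr1n => h.
by rewrite -(@ler_sqr R) ?nnegrE ?nrm_ge0 // expr1n.
Qed.

End L2.

Section BoundedOperators.
Variables (R : realType) (I J : choiceType).
Implicit Types (T : l2 R I -> l2 R J).

Lemma linear_op0 T : linear T -> T 0 = 0.
Proof. by move=> lT; have := lT (-1) 0 0; rewrite scaler0 addr0 scaleN1r addNr. Qed.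

Lemma linear_opD T : linear T -> forall u v, T (u + v) = T u + T v.
Proof. by move=> lT u v; have := lT 1 u v; rewrite !scale1r. Qed.

Lemma linear_opZ T : linear T -> forall c u, T (c *: u) = c *: T u.
Proof. by move=> lT c u; have := lT c u 0; rewrite !addr0 linear_op0 // addr0. Qed.

Lemma linear_opB T : linear T -> forall u v, T (u - v) = T u - T v.
Proof. by move=> lT u v; rewrite linear_opD // -scaleN1r linear_opZ // scaleN1r. Qed.

Lemma linear_op_sum T : linear T -> forall (K : Type) (r : seq K) (v : K -> l2 R I),
  T (\sum_(k <- r) v k) = \sum_(k <- r) T (v k).
Proof.
move=> lT K r v; elim: r => [|k r IH]; first by rewrite !big_nil linear_op0.
by rewrite !big_cons linear_opD // IH.
Qed.

(** Finite truncations of [u] converge to it in norm, and a coordinate of [T] is continuous. *)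
Lemma coord_has_sum T (M : R) : linear T -> (forall u, nrm (T u) <= M * nrm u) ->
  forall (u : l2 R I) j, has_sum (fun i => u i * T (delta R i) j) (T u j).
Proof.
(* [M] has no prescribed sign, so a positive bound is substituted before dividing. *)
move=> lT TM u j e e0; pose M1 := `|M| + 1.
have M1p : 0 < M1 by rewrite ltr_pwDr.
have eM : 0 < (e / M1) ^+ 2 by rewrite exprn_gt0 // divr_gt0.
have [F hF] := nrm_tail u eM; exists F => F' FF'.
rewrite (_ : \sum_(i <- F') _ = T (\sum_(i <- F') u i *: delta R i) j); last first.
  rewrite linear_op_sum // l2_sumE; apply: eq_bigr => i _.
  by rewrite linear_opZ.
rewrite -l2_subE -linear_opB //; apply: le_trans (coord_le_nrm _ _) _.
apply: le_trans (TM _) _; rewrite nrmB; set v := u - _.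
have vin i : i \in F' -> v i = 0.
  move=> iF'; rewrite /v l2_subE l2_sumE (sum_fset_single (i0 := i)) //.
    by rewrite l2_scaleE deltaE eqxx mulr1 subrr.
  by move=> k ki; rewrite l2_scaleE deltaE eq_sym (negPf ki) mulr0.
have vout i : i \notin F' -> v i = u i.
  move=> iF'; rewrite /v l2_subE l2_sumE big1_seq ?subr0 // => k /andP[_ kF'].
  by rewrite l2_scaleE deltaE; case: eqP kF' iF' => [->->//|_ _ _]; rewrite mulr0.
clearbody v; have : nrm v <= e / M1.
  apply: nrm_le; first by rewrite divr_ge0 // ltW.
  move=> E; apply: le_trans (hF (E `\` F') _); last first.
    by apply/fdisjointP => i iF; rewrite inE (fsubsetP FF' _ iF).
  rewrite (big_fsetID _ (mem F')) /= big1_seq ?add0r.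
    rewrite (_ : [fset x | x in E & x \notin F'] = E `\` F'); last first.
      by apply/fsetP => i; rewrite !inE andbC.
    rewrite big_seq [leRHS]big_seq; apply: ler_sum => i; rewrite inE => /andP[iF' _].
    by rewrite vout.
  by move=> i; rewrite !inE /= => /andP[_ iF']; rewrite vin ?normc0 ?expr0n.
move=> hv; apply: le_trans (_ : M1 * nrm v <= _).
  by rewrite ler_wpM2r ?nrm_ge0 // (le_trans (ler_norm M)) // lerDl.
by rewrite -ler_pdivlMl // mulrC.
Qed.

End BoundedOperators.

Section SumReindex.
Variables (R : realType) (I J : choiceType).

(** The bijection identifies the nets of finite subsets, so the image filters are equal and their
    limits agree without any convergence hypothesis. *)
Lemma sum_reindex (p : I -> J) (q : J -> I) (f : J -> R[i]) : cancel p q -> cancel q p ->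
  summability.sum (fun i => f (p i) : (R[i] : numFieldType)) =
  summability.sum (fun j => f j : (R[i] : numFieldType)).
Proof.
move=> pK qK; rewrite /summability.sum; congr (lim _).
have ps (A : {fset J}) : summability.partial_sum (fun i => f (p i)) (q @` A) =
    summability.partial_sum f A.
  rewrite /summability.partial_sum.
  rewrite -(big_seq_fsetE _ (q @` A) xpredT (fun i => f (p i))).
  rewrite -(big_seq_fsetE _ A xpredT (fun j => f j)) /=.
  rewrite big_imfset /=; last by move=> ? ? _ _ /(can_inj qK).
  by apply: eq_bigr => j _; rewrite qK.
have imK (A : {fset I}) : q @` (p @` A) = A.
  apply/fsetP => i; apply/imfsetP/idP => [[_ /= /imfsetP[i' /= iA ->] ->]|iA].
    by rewrite pK.
  by exists (p i); rewrite ?pK //; apply/imfsetP; exists i.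
have imK' (A : {fset J}) : p @` (q @` A) = A.
  apply/fsetP => i; apply/imfsetP/idP => [[_ /= /imfsetP[i' /= iA ->] ->]|iA].
    by rewrite qK.
  by exists (q i); rewrite ?qK //; apply/imfsetP; exists i.
have sub (K K' : choiceType) (h : K -> K') (A B : {fset K}) : A `<=` B -> h @` A `<=` h @` B.
  by move=> AB; apply: subset_imfset => x; exact: (fsubsetP AB).
apply/seteqP; split => P [A _ hA].
- exists (p @` A) => // B /= AB; rewrite -ps; apply: hA => /=.
  by rewrite -(imK A); exact: sub.
- exists (q @` A) => // B /= AB; rewrite -(imK B) ps; apply: hA => /=.
  by rewrite -(imK' A); exact: sub.
Qed.

Lemma sum_single (f : I -> R[i]) i0 : (forall i, i != i0 -> f i = 0) ->
  summability.sum (fun i => f i : (R[i] : numFieldType)) = f i0.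
Proof.
move=> f0; have tf := @summability.totally_filter I; apply: cvg_lim => //.
apply: cvg_near_cst.
exists [fset i0] => // A /=; rewrite fsub1set => iA; apply/eqP.
rewrite /summability.partial_sum -(big_seq_fsetE _ A xpredT (fun i => f i)) /=.
by rewrite (sum_fset_single f0).
Qed.

End SumReindex.

Lemma l2_dot_reindex (R : realType) (I J : choiceType) (p : I -> J) (q : J -> I)
    (u v : l2 R J) (u' v' : l2 R I) : cancel p q -> cancel q p ->
  (forall i, u' i * conjc (v' i) = u (p i) * conjc (v (p i))) -> l2_dot u' v' = l2_dot u v.
Proof.
move=> pK qK h; rewrite /l2_dot -(sum_reindex _ pK qK).
by have /funext -> : (fun i => u' i * conjc (v' i)) =1 (fun i => u (p i) * conjc (v (p i))).
Qed.

Lemma l2_dot_deltar (R : realType) (I : choiceType) (u : l2 R I) i : l2_dot u (delta R i) = u i.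
Proof.
rewrite /l2_dot (@sum_single R I (fun j => u j * conjc (delta R i j)) i).
  by rewrite deltaE eqxx conjc1 mulr1.
by move=> j /negPf ji; rewrite deltaE ji conjc0 mulr0.
Qed.

Lemma l2_dot_deltal (R : realType) (I : choiceType) (u : l2 R I) i :
  l2_dot (delta R i) u = conjc (u i).
Proof.
rewrite /l2_dot (@sum_single R I (fun j => delta R i j * conjc (u j)) i) ?deltaE ?eqxx ?mul1r //.
by move=> j /negPf ji; rewrite deltaE ji mul0r.
Qed.

(** * Matrix entries in the crossed product *)

Section Closure.
Variables (R : realType) (I : choiceType).
Implicit Types (T S : l2 R I -> l2 R I) (A : set (l2 R I -> l2 R I)).

Lemma bounded_operatorP T : bounded_operator T <->
  linear T /\ exists2 M : R, 0 <= M & forall u, nrm (T u) <= M * nrm u.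
Proof.
split=> -[lT]; last first.
  by move=> [M _ TM]; split => //; exists M => u; rewrite !normE -rmorphM lecR.
move=> [M TM]; split => //; exists `|M| => // u.
have := TM u; rewrite !normE -rmorphM lecR => /le_trans; apply.
by rewrite ler_wpM2r ?nrm_ge0 // ler_norm.
Qed.

Lemma norm_closureP A T : norm_closure A T <-> bounded_operator T /\
  forall e : R, 0 < e -> exists2 S, A S & forall u, nrm (T u - S u) <= e * nrm u.
Proof.
split=> -[bT h]; split => // e /h[S AS hS]; exists S => // u.
  by have := hS u; rewrite !normE -rmorphM lecR.
by rewrite !normE -rmorphM lecR.
Qed.

Lemma bounded_comp T S : bounded_operator T -> bounded_operator S -> bounded_operator (T \o S).
Proof.
move=> /bounded_operatorP[lT [M M0 TM]] /bounded_operatorP[lS [N N0 SN]].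
apply/bounded_operatorP; split; first by move=> c u v /=; rewrite lS lT.
exists (M * N) => [|u /=]; first exact: mulr_ge0.
by apply: le_trans (TM _) _; rewrite -mulrA ler_wpM2l.
Qed.

Lemma bounded_scale c T : bounded_operator T -> bounded_operator (c *: T).
Proof.
move=> /bounded_operatorP[lT [M M0 TM]]; apply/bounded_operatorP; split.
  move=> a u v.
  rewrite -[LHS]/(c *: T _) -[(c *: T) u]/(c *: T u) -[(c *: T) v]/(c *: T v) lT.
  by rewrite scalerDr !scalerA [c * a]mulrC.
exists (normc c * M) => [|u]; first by rewrite mulr_ge0 ?normc_ge0.
by rewrite -[(c *: T) u]/(c *: T u) nrmZ -mulrA ler_wpM2l ?normc_ge0.
Qed.

Lemma bounded_add T S : bounded_operator T -> bounded_operator S -> bounded_operator (T + S).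
Proof.
move=> /bounded_operatorP[lT [M M0 TM]] /bounded_operatorP[lS [N N0 SN]].
apply/bounded_operatorP; split.
  move=> c u v; rewrite -[LHS]/(T _ + S _) -[(T + S) u]/(T u + S u) -[(T + S) v]/(T v + S v).
  by rewrite lS lT scalerDr addrACA.
exists (M + N) => [|u /=]; first exact: addr_ge0.
by apply: le_trans (nrmD _ _) _; rewrite mulrDl lerD.
Qed.

Lemma bounded_zero : bounded_operator (0 : l2 R I -> l2 R I).
Proof.
apply/bounded_operatorP; split.
  by move=> c u v; rewrite -[LHS]/(0 : l2 R I) -[X in c *: X]/(0 : l2 R I) scaler0 addr0.
by exists 0 => // u; rewrite mul0r -[X in nrm X]/(0 : l2 R I) nrm0.
Qed.

Variable A : set (l2 R I -> l2 R I).
Hypothesis A_bounded : forall T, A T -> bounded_operator T.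

Lemma sub_norm_closure T : A T -> norm_closure A T.
Proof.
move=> AT; apply/norm_closureP; split => [|e e0]; first exact: A_bounded.
exists T => // u; rewrite subrr nrm0.
by rewrite mulr_ge0 ?nrm_ge0 // ltW.
Qed.

Lemma norm_closure_comp : (forall T S, A T -> A S -> A (T \o S)) ->
  forall T S, norm_closure A T -> norm_closure A S -> norm_closure A (T \o S).
Proof.
move=> Acomp T S /norm_closureP[bT hT] /norm_closureP[bS hS].
apply/norm_closureP; split => [|e e0]; first exact: bounded_comp.
have /bounded_operatorP[_ [N N0 SN]] := bS.
have e1 : 0 < e / 2 / (N + 1) by rewrite !divr_gt0 // ltr_wpDl.
have [T' AT' hT'] := hT _ e1.
have /bounded_operatorP[lT' [M M0 TM]] := A_bounded AT'.
(* [S'] is chosen after [T'], since its error gets multiplied by the bound [M] of [T']. *)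
have e2 : 0 < e / 2 / (M + 1) by rewrite !divr_gt0 // ltr_wpDl.
have [S' AS' hS'] := hS _ e2.
exists (T' \o S') => [|u /=]; first exact: Acomp.
apply: le_trans (nrm_triangle _ (T' (S u)) _) _.
have h1 : nrm (T (S u) - T' (S u)) <= e / 2 * nrm u.
  apply: le_trans (hT' _) _; apply: le_trans (_ : e / 2 / (N + 1) * (N * nrm u) <= _).
    by rewrite ler_wpM2l // ltW.
  rewrite mulrA ler_wpM2r ?nrm_ge0 // mulrAC ler_pdivrMr ?ltr_wpDl //.
  by rewrite ler_wpM2l ?lerDl // divr_ge0 // ltW.
have h2 : nrm (T' (S u) - T' (S' u)) <= e / 2 * nrm u.
  rewrite -linear_opB //; apply: le_trans (TM _) _.
  apply: le_trans (_ : M * (e / 2 / (M + 1) * nrm u) <= _); first by rewrite ler_wpM2l.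
  rewrite mulrA ler_wpM2r ?nrm_ge0 // mulrA ler_pdivrMr ?ltr_wpDl //.
  by rewrite mulrC ler_wpM2l ?lerDl // divr_ge0 // ltW.
by rewrite [e * _](_ : _ = e / 2 * nrm u + e / 2 * nrm u) ?lerD //; field.
Qed.

Lemma norm_closure_scale : (forall c T, A T -> A (c *: T)) ->
  forall c T, norm_closure A T -> norm_closure A (c *: T).
Proof.
move=> Ascale c T /norm_closureP[bT hT].
apply/norm_closureP; split => [|e e0]; first exact: bounded_scale.
have c1 : 0 < normc c + 1 by rewrite ltr_wpDl ?normc_ge0.
have [S AS hS] := hT _ (divr_gt0 e0 c1).
exists (c *: S) => [|u]; first exact: Ascale.
rewrite -[(c *: T) u]/(c *: T u) -[(c *: S) u]/(c *: S u) -scalerBr nrmZ.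
apply: le_trans (_ : (normc c + 1) * (e / (normc c + 1) * nrm u) <= _).
  by rewrite ler_pM ?normc_ge0 ?nrm_ge0 // lerDl.
by rewrite mulrA [(normc c + 1) * _]mulrC divfK // gt_eqF.
Qed.

End Closure.

Section CrossedProductTheory.
Variables (R : realType) (G : groupType).
Local Notation I := (G * G)%type.
Local Notation A0 := (algebraic_crossed_product R G).
Local Notation A := (reduced_crossed_product R G).
Implicit Types (f : linf R G) (g a b c d s x : G) (T S : l2 R I -> l2 R I).

Lemma linf_boundP f : exists2 M : R, 0 <= M & forall x, normc (f x) <= M.
Proof.
have [M hM] := linf_bounded f; exists M => //.
by apply: le_trans (hM 1%g); exact: normc_ge0.
Qed.

Lemma crossed_piE f (u : l2 R I) s x : crossed_pi f u (s, x) = f (s * x)%g * u (s, x).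
Proof. by rewrite /= invgK. Qed.

Lemma bounded_crossed_pi f : bounded_operator (crossed_pi f).
Proof.
apply/bounded_operatorP; split.
  move=> c u v; apply: l2_ext => -[s x].
  by rewrite crossed_piE !l2_addE !l2_scaleE !crossed_piE mulrDr mulrCA.
have [M M0 fM] := linf_boundP f; exists M => // u; apply: nrm_le => [|F].
  by rewrite mulr_ge0 ?nrm_ge0.
rewrite exprMn; apply: le_trans (_ : M ^+ 2 * \sum_(p <- F) normc (u p) ^+ 2 <= _).
  rewrite mulr_sumr; apply: ler_sum => -[s x] _; rewrite crossed_piE normcM exprMn.
  by rewrite ler_wpM2r ?sqr_ge0 // ler_sqr ?nnegrE ?normc_ge0.
by rewrite ler_wpM2l ?sqr_ge0 ?fset_sum_le_nrm.
Qed.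

Lemma bounded_crossed_lambda g : bounded_operator (@crossed_lambda R G g).
Proof.
apply/bounded_operatorP; split; first by move=> c u v; apply: l2_ext => -[s x].
exists 1 => // u; rewrite mul1r; apply: nrm_le => [|F]; first exact: nrm_ge0.
apply: le_trans (fset_sum_le_nrm u [fset ((g^-1 * p.1)%g, p.2) | p in F]).
rewrite big_imfset //= => -[s x] [s' x'] _ _ [/mulgI -> ->] //.
Qed.

Definition generator f g : l2 R I -> l2 R I := crossed_pi f \o crossed_lambda g.

Lemma generatorE f g (u : l2 R I) s x :
  generator f g u (s, x) = f (s * x)%g * u ((g^-1 * s)%g, x).
Proof. by rewrite /generator /= invgK. Qed.

Lemma bounded_generator f g : bounded_operator (generator f g).
Proof. exact: bounded_comp (bounded_crossed_pi f) (bounded_crossed_lambda g). Qed.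

Lemma op_sumE (K : Type) (r : seq K) (F : K -> l2 R I -> l2 R I) u :
  (\sum_(k <- r) F k) u = \sum_(k <- r) F k u.
Proof. by rewrite fct_sumE. Qed.

Lemma algebraic_generator f g : A0 (generator f g).
Proof. by exists 1%N, (fun=> f), (fun=> g); rewrite big_ord1. Qed.

Lemma algebraic0 : A0 0.
Proof.
have f0 (K : Type) : 'I_0 -> K by case.
by exists 0%N, (f0 _), (f0 _); rewrite big_ord0.
Qed.

Lemma algebraicD T S : A0 T -> A0 S -> A0 (T + S).
Proof.
move=> [n [f [g ->]]] [m [f' [g' ->]]].
exists (n + m)%N, (fun k => match fintype.split k with inl i => f i | inr j => f' j end),
  (fun k => match fintype.split k with inl i => g i | inr j => g' j end).
rewrite big_split_ord; congr (_ + _); apply: eq_bigr => k _.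
  by rewrite -[lshift m k]/(unsplit (inl k)) unsplitK.
by rewrite -[rshift n k]/(unsplit (inr k)) unsplitK.
Qed.

Lemma algebraic_sum (K : Type) (r : seq K) (F : K -> l2 R I -> l2 R I) :
  (forall k, A0 (F k)) -> A0 (\sum_(k <- r) F k).
Proof.
move=> hF; elim: r => [|k r IH]; first by rewrite big_nil; exact: algebraic0.
by rewrite big_cons; exact: algebraicD.
Qed.

Lemma algebraic_bounded T : A0 T -> bounded_operator T.
Proof.
move=> [n [f [g ->]]]; elim/big_ind: _ => [|U V|k _]; first exact: bounded_zero.
  exact: bounded_add.
exact: bounded_generator.
Qed.

Fact linf_mul_translate_subproof f g f' :
  exists M : R, forall x, normc (f x * f' (g^-1 * x)%g) <= M.
Proof.
have [M M0 fM] := linf_boundP f; have [N N0 fN] := linf_boundP f'.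
by exists (M * N) => x; rewrite normcM ler_pM ?normc_ge0.
Qed.

Lemma generator_comp f g f' g' : generator f g \o generator f' g' =
  generator (Linf (linf_mul_translate_subproof f g f')) (g * g')%g.
Proof.
apply/funext => u; apply: l2_ext => -[s x].
by rewrite [LHS]generatorE !generatorE /= invgM !mulgA mulrA.
Qed.

Fact linf_scale_subproof (c : R[i]) f : exists M : R, forall x, normc (c * f x) <= M.
Proof.
have [M M0 fM] := linf_boundP f.
by exists (normc c * M) => x; rewrite normcM ler_wpM2l ?normc_ge0.
Qed.

Lemma generator_scale (c : R[i]) f g :
  c *: generator f g = generator (Linf (linf_scale_subproof c f)) g.
Proof.
apply/funext => u; apply: l2_ext => -[s x].
by rewrite -[LHS]/(c * generator f g u (s, x)) !generatorE mulrA.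
Qed.

Lemma algebraic_scale (c : R[i]) T : A0 T -> A0 (c *: T).
Proof.
move=> [n [f [g ->]]]; rewrite scaler_sumr; apply: algebraic_sum => k.
by rewrite generator_scale; exact: algebraic_generator.
Qed.

Lemma algebraic_comp T S : A0 T -> A0 S -> A0 (T \o S).
Proof.
move=> [n [f [g ->]]] [m [f' [g' ->]]].
rewrite (_ : _ \o _ = \sum_(k < n) \sum_(l < m) (generator (f k) (g k) \o generator (f' l) (g' l))).
  apply: algebraic_sum => k; apply: algebraic_sum => l.
  by rewrite generator_comp; exact: algebraic_generator.
apply/funext => u /=; rewrite !op_sumE; apply: eq_bigr => k _; rewrite op_sumE.
rewrite -/(generator _ _) linear_op_sum //.
by have /bounded_operatorP[] := bounded_generator (f k) (g k).
Qed.

Lemma reduced_comp T S : A T -> A S -> A (T \o S).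
Proof. exact: norm_closure_comp algebraic_bounded algebraic_comp _ _. Qed.

Lemma reduced_scale (c : R[i]) T : A T -> A (c *: T).
Proof. exact: norm_closure_scale algebraic_scale _ _. Qed.

Lemma reduced_generator f g : A (generator f g).
Proof. exact: (sub_norm_closure (@algebraic_bounded) (algebraic_generator f g)). Qed.

Lemma reduced_bounded T : A T -> bounded_operator T.
Proof. by case. Qed.

Lemma reduced_approx T (e : R) : A T -> 0 < e ->
  exists2 S, A0 S & forall u, nrm (T u - S u) <= e * nrm u.
Proof. by move=> /norm_closureP[_ h] /h. Qed.

(** The matrix of [t] for an operator [t] tensor the identity, read on the fibre [x = 1]. *)
Definition entry T a b : R[i] := T (delta R ((b, 1%g) : I)) (a, 1%g).

Lemma algebraic_structure T s s' x x' : A0 T ->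
  T (delta R ((s', x) : I)) (s, x') = (x' == x)%:R * entry T (s * x')%g (s' * x')%g.
Proof.
move=> [n [f [g ->]]]; rewrite /entry !op_sumE !l2_sumE mulr_sumr; apply: eq_bigr => k _.
rewrite !generatorE !deltaE !xpair_eqE mulg1 eqxx andbT.
rewrite [in RHS]mulgA (inj_eq (mulIg x')); case: (x' == x); last by rewrite andbF mul0r mulr0.
by rewrite andbT mul1r.
Qed.

Lemma approx_eq0 (z : R[i]) : (forall e : R, 0 < e -> normc z <= e) -> z = 0.
Proof.
move=> h; apply/eqP; rewrite -normc_eq0 eq_le normc_ge0 andbT.
by apply/ler_addgt0Pr => e /h; rewrite add0r.
Qed.

Lemma coord_approx T S (e : R) p q : (forall u, nrm (T u - S u) <= e * nrm u) -> 0 <= e ->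
  normc (T (delta R p) q - S (delta R p) q) <= e.
Proof.
move=> h e0; rewrite -l2_subE; apply: le_trans (coord_le_nrm _ _) _.
apply: le_trans (h _) _; rewrite ler_piMr //; exact: nrm_delta.
Qed.

(* In the coordinates [(s * x, x)] the operators of the algebra are [t \otimes 1]. *)
Lemma reduced_structure T s s' x x' : A T ->
  T (delta R ((s', x) : I)) (s, x') = (x' == x)%:R * entry T (s * x')%g (s' * x')%g.
Proof.
move=> AT; apply/eqP; rewrite -subr_eq0; apply/eqP/approx_eq0 => e e0.
have e2 : 0 < e / 2 by rewrite divr_gt0.
have [S AS hS] := reduced_approx AT e2; have e2' := ltW e2.
have := coord_approx (s', x) (s, x') hS e2'.
rewrite (algebraic_structure s s' x x' AS).
have := coord_approx ((s' * x')%g, 1%g) ((s * x')%g, 1%g) hS e2'.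
rewrite -/(entry T _ _) -/(entry S _ _).
set p := entry T _ _; set q := entry S _ _; set t := T _ _; set b := (_%:R : R[i]) => h1 h2.
rewrite (_ : t - b * p = (t - b * q) - b * (p - q)); last by ring.
apply: le_trans (le_normcD _ _) _; rewrite normcN normcM.
have : normc b * normc (p - q) <= normc (p - q).
  by rewrite /b; case: (x' == x); rewrite ?normc1 ?mul1r // normc0 mul0r normc_ge0.
lra.
Qed.

Lemma reduced_coord_has_sum T (u : l2 R I) p : A T ->
  has_sum (fun q => u q * T (delta R q) p) (T u p).
Proof. by case/reduced_bounded/bounded_operatorP => lT [M _ TM]; exact: coord_has_sum TM _ _. Qed.

Lemma entry_ext T S : A T -> A S -> (forall a b, entry T a b = entry S a b) -> T = S.
Proof.
move=> AT AS e; apply/funext => u; apply: l2_ext => -[s x'].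
apply: has_sum_uniq (reduced_coord_has_sum u (s, x') AT) _.
apply: has_sum_ext (reduced_coord_has_sum u (s, x') AS) => -[s' x].
by rewrite (reduced_structure s s' x x' AT) (reduced_structure s s' x x' AS) e.
Qed.

(** [S] preserves the fibre [x = 1], so the sum over [G * G] reduces to this fibre. *)
Lemma entry_comp T S a b : A T -> A S ->
  has_sum (fun c => entry T a c * entry S c b) (entry (T \o S) a b).
Proof.
move=> AT AS.
have h := reduced_coord_has_sum (S (delta R (b, 1%g))) (a, 1%g) AT.
have inj : injective (fun c : G => (c, 1%g : G)) by move=> c c' [].
have := has_sum_inj inj _ h; rewrite /comp => /(_ _) hs.
apply: has_sum_ext (hs _) => [c|[s x] sx]; first by rewrite mulrC.
rewrite (reduced_structure _ _ _ _ AS); case: eqP => [e|_]; last by rewrite !mul0r.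
by have := sx s; rewrite e eqxx.
Qed.

Lemma entry_scale (c : R[i]) T a b : entry (c *: T) a b = c * entry T a b.
Proof. by []. Qed.

Lemma entry_generator f g a b : entry (generator f g) a b = f a * ((g^-1 * a)%g == b)%:R.
Proof. by rewrite /entry generatorE deltaE xpair_eqE eqxx andbT mulg1. Qed.

Fact indicator_subproof a : exists M : R, forall x, normc ((x == a)%:R : R[i]) <= M.
Proof. by exists 1 => x; case: eqP; rewrite ?normc1 ?normc0. Qed.

(** The usual matrix unit tensor the identity, obtained by cutting a translation down to one row. *)
Definition matrix_unit a b := generator (Linf (indicator_subproof a)) (a * b^-1)%g.

Lemma reduced_matrix_unit a b : A (matrix_unit a b).
Proof. exact: reduced_generator. Qed.

Lemma entry_matrix_unit a b c d : entry (matrix_unit a b) c d = (c == a)%:R * (d == b)%:R.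
Proof.
rewrite entry_generator /=; case: eqP => [->|_]; last by rewrite !mul0r.
by rewrite invgM invgK mulgVK eq_sym.
Qed.

Lemma entry_unit_comp T a b c d : A T ->
  entry (matrix_unit a b \o T) c d = (c == a)%:R * entry T b d.
Proof.
move=> AT; apply: has_sum_uniq (entry_comp c d (reduced_matrix_unit a b) AT) _.
have := @has_sum_single R G (fun e => entry (matrix_unit a b) c e * entry T e d) b.
rewrite entry_matrix_unit eqxx mulr1; apply => e /negPf eb.
by rewrite entry_matrix_unit eb mulr0 mul0r.
Qed.

Lemma entry_comp_unit T a b c d : A T ->
  entry (T \o matrix_unit a b) c d = entry T c a * (d == b)%:R.
Proof.
move=> AT; apply: has_sum_uniq (entry_comp c d AT (reduced_matrix_unit a b)) _.
have := @has_sum_single R G (fun e => entry T c e * entry (matrix_unit a b) e d) a.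
rewrite entry_matrix_unit eqxx mul1r; apply => e /negPf eb.
by rewrite entry_matrix_unit eb !mul0r mulr0.
Qed.

Lemma entry_sandwich T S a b c d : A T -> A S ->
  entry (T \o matrix_unit a b \o S) c d = entry T c a * entry S b d.
Proof.
move=> AT AS; rewrite (_ : _ \o _ = T \o (matrix_unit a b \o S)) //.
apply: has_sum_uniq (entry_comp c d AT (reduced_comp (reduced_matrix_unit a b) AS)) _.
have := @has_sum_single R G (fun e => entry T c e * entry (matrix_unit a b \o S) e d) a.
rewrite entry_unit_comp // eqxx mul1r; apply => e /negPf eb.
by rewrite entry_unit_comp // eb !mul0r mulr0.
Qed.

Lemma compress T a b a' b' : A T ->
  matrix_unit a a' \o T \o matrix_unit b' b = entry T a' b' *: matrix_unit a b.
Proof.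
move=> AT; apply: entry_ext => [||c d].
- exact: reduced_comp (reduced_comp (reduced_matrix_unit _ _) AT) (reduced_matrix_unit _ _).
- exact/reduced_scale/reduced_matrix_unit.
rewrite entry_comp_unit; last exact: reduced_comp (reduced_matrix_unit _ _) AT.
by rewrite entry_unit_comp // entry_scale entry_matrix_unit mulrCA mulrA.
Qed.

Lemma entry_generator_comp f g T a b : A T ->
  entry (generator f g \o T) a b = f a * entry T (g^-1 * a)%g b.
Proof.
move=> AT; rewrite -[LHS]/(generator f g (T (delta R (b, 1%g))) (a, 1%g)).
by rewrite generatorE mulg1.
Qed.

Lemma matrix_unit_adjoint a b : is_adjoint (matrix_unit a b) (matrix_unit b a).
Proof.
move=> u v.
apply: (@l2_dot_reindex _ _ _ (fun p : I => ((b * a^-1 * p.1)%g, p.2))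
                            (fun p : I => ((a * b^-1 * p.1)%g, p.2))).
- by move=> [s x] /=; rewrite !mulgA mulgVK mulgV mul1g.
- by move=> [s x] /=; rewrite !mulgA mulgVK mulgV mul1g.
move=> [s x] /=; rewrite !invgM !invgK.
rewrite !mulgA !mulgVK mulgV mul1g.
have -> : ((b * a^-1 * s * x)%g == b) = ((s * x)%g == a).
  by rewrite -!mulgA -{2}[b]mulg1 (inj_eq (mulgI b)) -(inj_eq (mulgI a)) mulVKg mulg1.
by case: (_ == a); rewrite ?mul1r // !mul0r conjc0 mulr0.
Qed.

Lemma entry_adjoint T S a b : is_adjoint T S -> entry T a b = conjc (entry S b a).
Proof.
move=> /(_ (delta R (b, 1%g)) (delta R (a, 1%g))).
by rewrite l2_dot_deltar l2_dot_deltal.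
Qed.

End CrossedProductTheory.

(** * The implementing unitary *)

Section CrossedIso.
Variable R : realType.
Local Notation op G := (l2 R (G * G)%type -> l2 R (G * G)%type).
Local Notation A G := (reduced_crossed_product R G).
Local Notation E := (@matrix_unit R _).

(** Carries the inverse as data, so that each statement transfers to the other direction by
    [crossed_iso_sym]. *)
Record crossed_iso (G L : groupType) (Phi : op G -> op L) (Psi : op L -> op G) : Prop :=
  CrossedIso {
  iso_to : forall T, A G T -> A L (Phi T);
  iso_from : forall S, A L S -> A G (Psi S);
  isoK : forall T, A G T -> Psi (Phi T) = T;
  isoVK : forall S, A L S -> Phi (Psi S) = S;
  isoM : forall T1 T2, A G T1 -> A G T2 -> Phi (T1 \o T2) = Phi T1 \o Phi T2;
  isoZ : forall (c : R[i]) T, A G T -> Phi (c *: T) = c *: Phi T }.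

Lemma crossed_iso_sym (G L : groupType) (Phi : op G -> op L) (Psi : op L -> op G) :
  crossed_iso Phi Psi -> crossed_iso Psi Phi.
Proof.
case=> to from K VK M Z; constructor; [exact: from|exact: to|exact: VK|exact: K| |].
- move=> S1 S2 B1 B2; have [A1 A2] := (from _ B1, from _ B2).
  by rewrite -{1}(VK _ B1) -{1}(VK _ B2) -(M _ _ A1 A2) (K _ (reduced_comp A1 A2)).
- move=> c S BS; have AS := from _ BS.
  by rewrite -{1}(VK _ BS) -(Z _ _ AS) (K _ (reduced_scale _ AS)).
Qed.

Lemma star_isomorphic_iso (G L : groupType) : star_isomorphic (A G) (A L) ->
  exists (Phi : op G -> op L) (Psi : op L -> op G), crossed_iso Phi Psi /\
    forall T T', A G T -> A G T' -> is_adjoint T T' -> is_adjoint (Phi T) (Phi T').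
Proof.
move=> [Phi [[Pf Pi Ps] _ PZ PM Padj]].
have Psi_ex S : exists T, A L S -> A G T /\ Phi T = S.
  have [BS|nB] := pselect (A L S); last by exists 0.
  by have [T AT TS] := Ps _ BS; exists T.
pose Psi S := projT1 (cid (Psi_ex S)).
have PsiP S : A L S -> A G (Psi S) /\ Phi (Psi S) = S by exact: projT2 (cid (Psi_ex S)).
exists Phi, Psi; split => //; split => //.
- by move=> S /PsiP[].
- move=> T AT; have [APP PP] := PsiP _ (Pf _ AT).
  by apply: Pi => //; rewrite inE.
- by move=> S /PsiP[].
Qed.

Section MatrixUnits.
Variables (G L : groupType) (Phi : op G -> op L) (Psi : op L -> op G).
Hypothesis iso : crossed_iso Phi Psi.
Implicit Types (a b : G) (c d : L).

Let AE a b := @reduced_matrix_unit R G a b.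
Let BE c d := @reduced_matrix_unit R L c d.
Let APsi c d : A G (Psi (E c d)) := iso_from iso (BE c d).
Let APhi a b : A L (Phi (E a b)) := iso_to iso (AE a b).

Definition phi_coef a b c d : R[i] := entry (Phi (E a b)) c d.
Definition psi_coef c d a b : R[i] := entry (Psi (E c d)) a b.

(** [Phi] is applied to [E a a' \o Psi (E c' d') \o E b' b], a scalar multiple of [E a b]. The
    relation expresses that images of matrix units have rank one. *)
Lemma coef_relation a a' b b' c c' d d' :
  phi_coef a a' c c' * phi_coef b' b d' d = psi_coef c' d' a' b' * phi_coef a b c d.
Proof.
rewrite /phi_coef -entry_sandwich //.
have -> : Phi (E a a') \o E c' d' \o Phi (E b' b) =
    psi_coef c' d' a' b' *: Phi (E a b).
  rewrite -{1}(isoVK iso (BE c' d')) -!(isoM iso) ?compress ?(isoZ iso) //.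
  exact: reduced_comp.
by rewrite entry_scale.
Qed.

Lemma phi_coef_has_sum a b b' a' c d :
  has_sum (fun e => phi_coef a b c e * phi_coef b' a' e d) ((b == b')%:R * phi_coef a a' c d).
Proof.
have := entry_comp c d (APhi a b) (APhi b' a'); rewrite -(isoM iso) //.
have -> : E a b \o E b' a' = (b == b')%:R *: E a a'.
  apply: entry_ext => [||x y]; first exact: reduced_comp.
    exact: reduced_scale.
  by rewrite entry_unit_comp // entry_scale !entry_matrix_unit mulrCA.
by rewrite (isoZ iso).
Qed.

Lemma iso_neq0 T : A G T -> (exists a b, entry T a b != 0) -> exists c d, entry (Phi T) c d != 0.
Proof.
move=> AT [a [b Tab]]; apply: contrapT => h; case/eqP: Tab.
have e0 : Phi T = Phi (0 *: T).
  apply: entry_ext; [exact: iso_to iso _ AT|exact: iso_to iso _ (reduced_scale _ AT)|move=> c d].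
  rewrite (isoZ iso) // entry_scale mul0r.
  by apply/eqP; apply: contraT => n0; case: h; exists c, d.
have := congr1 Psi e0; rewrite (isoK iso AT) (isoK iso (reduced_scale _ AT)) => ->.
by rewrite entry_scale mul0r.
Qed.

End MatrixUnits.

Section Unitary.
Variables (G L : groupType) (Phi : op G -> op L) (Psi : op L -> op G).
Hypothesis iso : crossed_iso Phi Psi.
Hypothesis Phi_adjoint : forall T T', A G T -> A G T' -> is_adjoint T T' ->
  is_adjoint (Phi T) (Phi T').
Implicit Types (a b : G) (c d : L).

Local Notation w := (phi_coef Phi).
Local Notation w' := (psi_coef Psi).

Lemma phi_coef_conj a b c d : w b a d c = conjc (w a b c d).
Proof.
apply: entry_adjoint; apply: Phi_adjoint; try exact: reduced_matrix_unit.
exact: matrix_unit_adjoint.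
Qed.

Lemma phi_coef_diag_mass a d :
  has_sum (fun e => ((normc (w a a d e) ^+ 2)%:C)%C) (w a a d d).
Proof.
have := phi_coef_has_sum iso a a a a d d; rewrite eqxx mul1r.
by apply: has_sum_ext => e; rewrite -mulc_conj -phi_coef_conj.
Qed.

Lemma phi_coef_diag_real a d : w a a d d = ((complex.Re (w a a d d))%:C)%C.
Proof.
have := phi_coef_conj a a d d; case: (w a a d d) => x y [yy] /=.
by rewrite (_ : y = 0) //; lra.
Qed.

Lemma phi_coef_diag_ge a c d : normc (w a a d c) ^+ 2 <= complex.Re (w a a d d).
Proof.
have := phi_coef_diag_mass a d; rewrite phi_coef_diag_real => h.
have := has_sum_real_le [fset c] (fun e => sqr_ge0 (normc (w a a d e))) h.
by rewrite big_seq_fset1.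
Qed.

(** The image of [E a a] is a nonzero self-adjoint idempotent, so a diagonal entry dominates the
    squared modulus of any entry in its row. *)
Lemma phi_coef_diag_pos a : exists c, 0 < complex.Re (w a a c c).
Proof.
have [|c [d cd]] := iso_neq0 iso (@reduced_matrix_unit R _ a a).
  by exists a, a; rewrite entry_matrix_unit !eqxx mulr1 oner_eq0.
exists c; apply: lt_le_trans (phi_coef_diag_ge a d c).
by rewrite exprn_gt0 // lt_def normc_eq0 normc_ge0 andbT.
Qed.

(* With a base pair [a0, c0], [u a] is the image of the basis vector at [a] under
   the unitary implementing the isomorphism. *)
Lemma implementing_unitary : exists u : G -> L -> R[i],
  [/\ forall a b c d, w a b c d = u a c * conjc (u b d),
      forall a b c d, w' c d a b = conjc (u a c) * u b d,
      forall a, exists c, u a c != 0 & forall c, exists a, u a c != 0].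
Proof.
pose a0 : G := 1%g; have [c0 k0] := phi_coef_diag_pos a0.
set k := complex.Re _ in k0; have kE : w a0 a0 c0 c0 = (k%:C)%C := phi_coef_diag_real a0 c0.
have kC : (k%:C)%C != 0 :> R[i] by rewrite eq_complex /= eqxx andbT gt_eqF.
(* By [coef_relation], [k * w a b c d] is [w a a0 c c0 * w a0 b c0 d]; each of the two factors
   receives one square root of [k]. *)
pose s := Num.sqrt k; have s0 : 0 < s by rewrite sqrtr_gt0.
have sk : (s%:C)%C * (s%:C)%C = (k%:C)%C :> R[i].
  by rewrite -rmorphM /= -expr2 sqr_sqrtr // ltW.
have sC : (s%:C)%C != 0 :> R[i] by rewrite eq_complex /= eqxx andbT gt_eqF.
pose u a c := w a a0 c c0 / (s%:C)%C.
have uJ b d : conjc (u b d) = conjc (w b a0 d c0) / (s%:C)%C.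
  by rewrite /u rmorphM fmorphV; congr (_ * _^-1); exact: conjc_real.
have wu a b c d : w a b c d = u a c * conjc (u b d).
  have w00 : w' c0 c0 a0 a0 = (k%:C)%C.
    have := coef_relation iso a0 a0 a0 a0 c0 c0 c0 c0.
    by rewrite !kE => /(mulIf kC).
  have := coef_relation iso a a0 b a0 c c0 d c0; rewrite w00 -sk => h.
  rewrite uJ /u -phi_coef_conj mulrACA -invfM h.
  by rewrite mulrAC divff ?mul1r // mulf_neq0.
have u00 : u a0 c0 != 0 by rewrite /u kE -sk mulfK.
have w'u a b c d : w' c d a b = conjc (u a c) * u b d.
  have := coef_relation iso a0 a a0 b c0 c c0 d; rewrite !wu => h.
  have n0 : u a0 c0 * conjc (u a0 c0) != 0 by rewrite mulf_neq0 // conjc_eq0.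
  by apply: (mulIf n0); rewrite -h; ring.
exists u; split => // [a|c].
  have [c] := phi_coef_diag_pos a; rewrite wu => h; exists c.
  by apply: contraTneq h => ->; rewrite mul0r ltxx.
have [|a [b]] := iso_neq0 (crossed_iso_sym iso) (@reduced_matrix_unit R _ c c).
  by exists c, c; rewrite entry_matrix_unit !eqxx mulr1 oner_eq0.
rewrite -/(w' c c a b) w'u => h; exists a.
by apply: contraNneq h => ->; rewrite conjc0 mul0r.
Qed.

End Unitary.

(** The entries of the image of [E b b \o E b' b'] contain the inner product of two rows times a
    scalar, which can be taken nonzero and cancelled. *)
Lemma implemented_rows (G L : groupType) (Phi : op G -> op L) (Psi : op L -> op G)
    (u : G -> L -> R[i]) :
  crossed_iso Phi Psi ->
  (forall a b c d, phi_coef Phi a b c d = u a c * conjc (u b d)) ->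
  (forall a, exists c, u a c != 0) -> orthonormal_rows u.
Proof.
move=> iso wu u0 b' b; have [c uc] := u0 b; have [d ud] := u0 b'.
have := phi_coef_has_sum iso b b b' b' c d.
have n0 : u b c * conjc (u b' d) != 0 by rewrite mulf_neq0 // conjc_eq0.
move=> /(has_sumZ (u b c * conjc (u b' d))^-1); rewrite wu [X in has_sum _ X]mulrC mulfK //.
by rewrite eq_sym; apply: has_sum_ext => e; rewrite !wu; field; rewrite ?uc ?conjc_eq0 ?ud.
Qed.

(** Compressing the image of the generator between [E c c] and [E d d] isolates one entry; pulled
    back by [Psi], it becomes a sum over [e] with a common nonzero factor. Translation by [g^-1]
    pairs [e] with [g * e]. *)
Lemma implemented_conjugate (G L : groupType) (Phi : op G -> op L) (Psi : op L -> op G)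
    (u : G -> L -> R[i]) (f : linf R G) (g : G) :
  crossed_iso Phi Psi ->
  (forall a b c d, psi_coef Psi c d a b = conjc (u a c) * u b d) ->
  (forall c, exists a, u a c != 0) ->
  forall c d, has_sum (fun e => f e * (u e c * conjc (u (g * e)%g d)))
     (entry (Phi (generator f g^-1%g)) c d).
Proof.
move=> iso wu u0 c d; have [a uc] := u0 c; have [b ud] := u0 d.
set T := generator f g^-1%g; have AT : reduced_crossed_product R G T by exact: reduced_generator.
have iso' := crossed_iso_sym iso.
have BE := @reduced_matrix_unit R L.
have AP c' d' := iso_from iso (BE c' d').
have BT := iso_to iso AT.
have e1 : Psi (E c c) \o T \o Psi (E d d) =
   entry (Phi T) c d *: Psi (E c d).
  rewrite -{1}(isoK iso AT) -(isoM iso' (BE c c) BT).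
  rewrite -(isoM iso' (reduced_comp (BE c c) BT) (BE d d)).
  by rewrite (compress _ _ _ _ BT) (isoZ iso' _ (BE c d)).
have := entry_comp a b (AP c c) (reduced_comp AT (AP d d)).
rewrite [X in entry X a b](e1 : _ \o (_ \o _) = _).
rewrite entry_scale -/(psi_coef Psi c d a b) wu.
have n0 : conjc (u a c) * u b d != 0 by rewrite mulf_neq0 // conjc_eq0.
move=> /(has_sumZ (conjc (u a c) * u b d)^-1); rewrite [X in has_sum _ X]mulrC mulfK //.
apply: has_sum_ext => e; rewrite (entry_generator_comp _ _ _ _ (AP d d)) invgK.
rewrite -/(psi_coef Psi c c a e) -/(psi_coef Psi d d (g * e)%g b) !wu.
by field; rewrite ud conjc_eq0 uc.
Qed.

(** An element of the algebraic crossed product has finitely many translations, hence finite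
    propagation and bounded entries. The norm error is tested on vectors of the fibre [x = 1]. *)
Lemma reduced_approximable (G : groupType) (lG : proper_length G) (T : op G) :
  A G T -> approximable lG (entry T).
Proof.
move=> AT e e0; have [S AS hS] := reduced_approx AT e0.
have [n [f [g SE]]] := AS.
have lS := (bounded_operatorP S).1 (algebraic_bounded AS).
have lT := (bounded_operatorP T).1 (reduced_bounded AT).
have entryS a b : entry S a b = \sum_(k < n) f k a * (((g k)^-1 * a)%g == b)%:R.
  by rewrite SE /entry op_sumE l2_sumE; apply: eq_bigr => k _; rewrite -entry_generator.
have fM k := cid2 (linf_boundP (f k)).
exists (\max_(k < n) lG (g k))%N, (\sum_(k < n) s2val (fM k)), (entry S); split.
- move=> y y' far; rewrite entryS big1 // => k _; case: eqP => [e1|]; last by rewrite mulr0.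
  move: far; rewrite -e1 invgM invgK mulVKg.
  by rewrite ltnNge (leq_bigmax (F := fun k => lG (g k)) k).
- move=> y y'; rewrite entryS; apply: le_trans (normc_sum _ _ _) _; apply: ler_sum => k _.
  have := s2valP' (fM k) y; have := s2valP (fM k).
  by rewrite normcM; case: (_ == _); rewrite ?normc1 ?mulr1 // normc0 mulr0.
move=> v v' Z; pose V := \sum_(y' <- Z) v y' *: delta R (y', 1%g : G).
pose D := T V - S V.
have DE y : \sum_(y' <- Z) (entry T y y' - entry S y y') * v y' = D (y, 1%g).
  rewrite /D l2_subE /V (linear_op_sum lT.1) (linear_op_sum lS.1) !l2_sumE -sumrB.
  apply: eq_bigr => y' _; rewrite (linear_opZ lT.1) (linear_opZ lS.1) !l2_scaleE.
  by rewrite mulrBl ![_ * v y']mulrC.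
have V2 : nrm V ^+ 2 <= \sum_(y <- Z) normc (v y) ^+ 2.
  have := nrm_combination (fun p : G * G => v p.1) [fset (y, 1%g) | y in Z].
  by rewrite !big_imfset //=; move=> y y' _ _ [].
have D2 : \sum_(y <- Z) normc (D (y, 1%g)) ^+ 2 <= e ^+ 2 * \sum_(y <- Z) normc (v y) ^+ 2.
  have := fset_sum_le_nrm D [fset (y, 1%g) | y in Z].
  rewrite big_imfset /=; last by move=> y y' _ _ [].
  move=> /le_trans; apply; apply: le_trans (_ : (e * nrm V) ^+ 2 <= _).
    by rewrite ler_sqr ?nnegrE ?nrm_ge0 ?mulr_ge0 ?nrm_ge0 ?(ltW e0) ?hS.
  by rewrite exprMn ler_wpM2l ?sqr_ge0.
(* The weight [e] balances the two squares, since [D] has squared norm at most [e^2] times that of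
   [v]. *)
apply: le_trans (_ : \sum_(y <- Z) (normc (D (y, 1%g)) ^+ 2 / e + e * normc (v' y) ^+ 2) <= _).
  apply: le_trans (normc_sum _ _ _) _; apply: ler_sum => y _.
  rewrite -mulr_suml DE normcM -subr_ge0.
  have -> : normc (D (y, 1%g)) ^+ 2 / e + e * normc (v' y) ^+ 2 - normc (D (y, 1%g)) * normc (v' y)
     = ((normc (D (y, 1%g)) - e * normc (v' y)) ^+ 2 + normc (D (y, 1%g)) * normc (v' y) * e) / e.
    by field; exact: lt0r_neq0.
  by rewrite divr_ge0 ?addr_ge0 ?sqr_ge0 ?mulr_ge0 ?normc_ge0 ?(ltW e0).
rewrite big_split /= -mulr_suml -mulr_sumr mulrDr lerD2r ler_pdivrMr //.
by rewrite mulrAC -expr2.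
Qed.

Lemma implemented_approximable (G L : groupType) (lL : proper_length L)
    (Phi : op G -> op L) (Psi : op L -> op G) (u : G -> L -> R[i]) :
  crossed_iso Phi Psi ->
  (forall a b c d, psi_coef Psi c d a b = conjc (u a c) * u b d) ->
  (forall c, exists a, u a c != 0) ->
  conjugates_approximable lL u.
Proof.
move=> iso wu u0 g f f1; pose F := Linf (ex_intro (fun M => forall x, normc (f x) <= M) 1 f1).
exists (entry (Phi (generator F g^-1%g))).
  exact/reduced_approximable/(iso_to iso)/reduced_generator.
by move=> y y'; exact: (implemented_conjugate F g iso wu u0).
Qed.

End CrossedIso.

(** * Word metrics and the conclusion *)

Section WordLength.
Variables (G : groupType) (S : genset G).

Definition letters : {fset G} := gens S `|` [fset (x^-1)%g | x in gens S].

Lemma in_letters x : (x \in letters) = (x \in gens S) || ((x^-1)%g \in gens S).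
Proof.
rewrite inE; congr (_ || _); apply/imfsetP/idP => [[y /= yS ->]|xS]; first by rewrite invgK.
by exists (x^-1)%g; rewrite ?invgK.
Qed.

Lemma word_length_letter x : x \in letters -> (word_length S x <= 1)%N.
Proof.
rewrite in_letters => xS; have := @word_length_min G S [:: x].
by rewrite /word_val big_seq1 /= andbT; apply.
Qed.

Fixpoint word_ball n : {fset G} :=
  if n is n'.+1 then word_ball n' `|` [fset (x * b)%g | x in letters, b in word_ball n']
  else [fset 1%g].

Lemma in_word_ball n x : (x \in word_ball n) = (word_length S x <= n)%N.
Proof.
apply/idP/idP.
  elim: n x => [|n IH] x /=; first by rewrite inE => /eqP ->; rewrite word_length1.
  rewrite inE => /orP[/IH/leqW //|/imfset2P[y /= yS [b /= /IH bn ->]]].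
  apply: leq_trans (word_lengthM _ _ _) _.
  by rewrite -add1n leq_add // word_length_letter.
have [w [Sw <- <-]] := word_lengthP S x.
have mono k l : (k <= l)%N -> word_ball k `<=` word_ball l.
  move=> /subnK <-; elim: (l - k)%N => // d IH; rewrite addSn /=.
  by apply: fsubset_trans IH _; exact: fsubsetUl.
move=> /mono/fsubsetP; apply; elim: w Sw => [|y w IH] /=.
  by rewrite /word_val big_nil inE.
move=> /andP[yS Sw]; rewrite /word_val big_cons inE; apply/orP; right.
by apply/imfset2P; exists y; rewrite /= ?in_letters //; exists (word_val w); rewrite ?IH.
Qed.

Definition word_proper : proper_length G :=
  ProperLength (word_length1 S) (word_lengthV S) (word_lengthM S) in_word_ball.

Lemma countable_group : countable [set: G].
Proof.
rewrite (_ : [set: G] = (\bigcup_(n in [set: nat]) [set` word_ball n])%classic).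
  by apply: bigcup_countable => // n _; exact: finite_set_countable.
apply/seteqP; split => // x _; exists (word_length S x) => //=.
by rewrite in_word_ball.
Qed.

End WordLength.

Section Lipschitz.
Variables (R : realType) (G L : groupType) (S : genset G) (T : genset L).

(** A shortest word leads from [x] to [x'] one letter at a time, and each letter moves the image by
    at most [n]. *)
Lemma coarse_word (h : G -> L) n : (forall x x', (word_length S (x' * x^-1)%g <= 1)%N ->
    (word_length T (h x' * (h x)^-1)%g <= n)%N) ->
  forall x x', (word_length T (h x' * (h x)^-1)%g <= n * word_length S (x' * x^-1)%g)%N.
Proof.
move=> hn x x'; have [w [Sw wx <-]] := word_lengthP S (x' * x^-1)%g.
have -> : x' = (word_val w * x)%g by rewrite wx mulgVK.
elim: w {wx} Sw => [|y w IH] /=.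
  by rewrite /word_val big_nil mul1g mulgV word_length1.
move=> /andP[yS Sw]; rewrite /word_val big_cons -/(word_val w) -mulgA.
set z := (word_val w * x)%g.
rewrite (_ : (h (y * z) * _)%g = ((h (y * z) * (h z)^-1) * (h z * (h x)^-1))%g); last first.
  by rewrite -mulgA mulKg.
apply: leq_trans (word_lengthM _ _ _) _; rewrite mulnS leq_add ?IH //.
by apply: hn; rewrite mulgK; apply: word_length_letter; rewrite in_letters.
Qed.

(* Inversion exchanges the right-invariant metric of the operator side with the
   left-invariant word metric. *)
Lemma lipschitz_of_coarse (h : G -> L) : coarse (word_proper S) (word_proper T) h ->
  lipschitz_map (fun x : word_space R S => ((h (x : G)^-1)^-1)%g : word_space R T).
Proof.
move=> /(_ 1%N)[n hn]; exists n%:R => x y.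
rewrite -[mdist x y]/((word_length S ((x : G)^-1 * (y : G))%g)%:R).
rewrite -[mdist _ _]/((word_length T ((h (x : G)^-1)^-1^-1 * (h (y : G)^-1)^-1)%g)%:R).
rewrite -natrM ler_nat invgK.
by have := coarse_word hn (y : G)^-1%g (x : G)^-1%g; rewrite invgK.
Qed.

Lemma coarse_of_lipschitz (f : word_space R S -> word_space R T) : lipschitz_map f ->
  coarse (word_proper S) (word_proper T) (fun x : G => ((f (x^-1)%g : L)^-1)%g).
Proof.
move=> [M fM] r; exists (Num.bound (`|M| * r%:R)) => x x' l.
rewrite invgK -(ler_nat R) ltW //; apply: le_lt_trans (archi_boundP _); last by rewrite mulr_ge0.
have := fM (x'^-1)%g (x^-1)%g.
rewrite -[mdist _ _]/((word_length T ((f x'^-1 : L)^-1 * (f x^-1 : L))%g)%:R).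
rewrite -[mdist _ _]/((word_length S ((x'^-1)^-1 * x^-1)%g)%:R) invgK => /le_trans; apply.
apply: le_trans (_ : `|M| * (word_length S (x' * x^-1)%g)%:R <= _).
  by rewrite ler_wpM2r // ler_norm.
by rewrite ler_wpM2l // ler_nat.
Qed.

End Lipschitz.

(** * Conjugation of operators by a bijection of the groups *)

Section Reindexing.
Variables (R : realType) (I J : choiceType) (p : J -> I) (q : I -> J).
Hypotheses (pK : cancel p q) (qK : cancel q p).

Fact reindex_subproof (u : l2 R I) : (fun j => u (p j)) \in @l2_pred R J.
Proof.
apply/l2_predP; apply: (@le_lt_trans _ _ (nrm u ^+ 2)%:E); last by rewrite ltry.
apply: sqsum_le => F; apply: le_trans (fset_sum_le_nrm u (p @` F)).
by rewrite big_imfset //= => j j' _ _ /(can_inj pK).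
Qed.

Definition reindex_l2 (u : l2 R I) : l2 R J := L2 (reindex_subproof u).

Lemma nrm_reindex_le u : nrm (reindex_l2 u) <= nrm u.
Proof.
apply: nrm_le => [|F]; first exact: nrm_ge0.
apply: le_trans (fset_sum_le_nrm u (p @` F)).
by rewrite big_imfset //= => j j' _ _ /(can_inj pK).
Qed.

Lemma reindex_dot u v : l2_dot (reindex_l2 u) (reindex_l2 v) = l2_dot u v.
Proof. exact: l2_dot_reindex pK qK _. Qed.

End Reindexing.

Section Conjugation.
Variables (R : realType) (G L : groupType) (lG : proper_length G) (lL : proper_length L).
Variables (h : G -> L) (h' : L -> G).
Hypotheses (hK : cancel h h') (h'K : cancel h' h) (h_coarse : coarse lG lL h).
Local Notation op K := (l2 R (K * K)%type -> l2 R (K * K)%type).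

(* In the coordinates [(s * x, x)] this is [h] on both factors. *)
Definition twist (K K' : groupType) (k : K -> K') (r : K * K) : K' * K' :=
  ((k (r.1 * r.2) * (k r.2)^-1)%g, k r.2).

Lemma twistK (K K' : groupType) (k : K -> K') (k' : K' -> K) : cancel k k' ->
  cancel (twist k) (twist k').
Proof. by move=> kK [s x]; rewrite /twist /= mulgVK !kK mulgK. Qed.

Definition push : l2 R (G * G)%type -> l2 R (L * L)%type := reindex_l2 (twistK h'K).
Definition pull : l2 R (L * L)%type -> l2 R (G * G)%type := reindex_l2 (twistK hK).

Definition conjugate (T : op G) : op L := push \o T \o pull.

Lemma pushK u : pull (push u) = u.
Proof. by apply: l2_ext => r /=; rewrite (twistK hK). Qed.

Lemma pullK u : push (pull u) = u.
Proof. by apply: l2_ext => r /=; rewrite (twistK h'K). Qed.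

Fact conjugate_coef_subproof (f : linf R G) g k : exists M : R, forall y : L,
  normc (f (h' y) * ((y * (h (g^-1 * h' y))^-1)%g == k)%:R) <= M.
Proof.
have [M M0 fM] := linf_boundP f; exists M => y; rewrite normcM.
by case: (_ == _); rewrite ?normc1 ?mulr1 // normc0 mulr0.
Qed.

(** At [y] the conjugate acts with displacement [y * (h (g^-1 * h' y))^-1], which coarseness
    confines to a finite ball. Sorting the points by this displacement [k] gives one generator for
    each [k]. *)
Lemma conjugate_generator (f : linf R G) g :
  algebraic_crossed_product R L (conjugate (generator f g)).
Proof.
have [n hn] := h_coarse (lG g).
rewrite (_ : conjugate _ = \sum_(k <- length_ball lL n)
    generator (Linf (conjugate_coef_subproof f g k)) k).
  by apply: algebraic_sum => k; exact: algebraic_generator.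
apply/funext => v; apply: l2_ext => -[t z]; rewrite op_sumE l2_sumE.
pose k0 := ((t * z) * (h (g^-1 * h' (t * z)%g))^-1)%g.
have k0n : k0 \in length_ball lL n.
  rewrite in_length_ball /k0 -{1}[(t * z)%g]h'K; apply: hn.
  by rewrite invgM invgK mulVKg.
rewrite (sum_fset_single (i0 := k0)) //; last first.
  by move=> k /negPf kk0; rewrite generatorE /= eq_sym kk0 mulr0 mul0r.
rewrite generatorE /= eqxx mulr1 invgK mulgVK; congr (_ * v _).
by rewrite /twist /= !mulgA mulgVK h'K /k0 invgM invgK invgM !mulgA mulgVK.
Qed.

Lemma conjugate_sum (K : Type) (r : seq K) (F : K -> op G) :
  conjugate (\sum_(k <- r) F k) = \sum_(k <- r) conjugate (F k).
Proof.
apply/funext => v; apply: l2_ext => j; rewrite op_sumE l2_sumE.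
by rewrite /conjugate /= op_sumE l2_sumE.
Qed.

Lemma conjugate_algebraic T : algebraic_crossed_product R G T ->
  algebraic_crossed_product R L (conjugate T).
Proof.
move=> [n [f [g ->]]]; rewrite conjugate_sum; apply: algebraic_sum => k.
exact: conjugate_generator.
Qed.

Lemma conjugate_reduced T : reduced_crossed_product R G T ->
  reduced_crossed_product R L (conjugate T).
Proof.
move=> /norm_closureP[/bounded_operatorP[lT [M M0 TM]] hT]; apply/norm_closureP; split.
  apply/bounded_operatorP; split.
    move=> c u v; rewrite /conjugate /=.
    rewrite (_ : pull (c *: u + v) = c *: pull u + pull v); last exact: l2_ext.
    by rewrite lT; apply: l2_ext.
  exists M => // u; apply: le_trans (nrm_reindex_le _ _) _; apply: le_trans (TM _) _.
  by rewrite ler_wpM2l // nrm_reindex_le.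
move=> e e0; have [S AS hS] := hT e e0; exists (conjugate S); first exact: conjugate_algebraic.
move=> u; rewrite (_ : _ - _ = push (T (pull u) - S (pull u))); last exact: l2_ext.
apply: le_trans (nrm_reindex_le _ _) _; apply: le_trans (hS _) _.
by rewrite ler_wpM2l ?(ltW e0) // nrm_reindex_le.
Qed.

Lemma conjugate_adjoint T T' : is_adjoint T T' -> is_adjoint (conjugate T) (conjugate T').
Proof.
move=> adj u v; rewrite /conjugate /= -{1}[v]pullK -{2}[u]pullK.
rewrite !(reindex_dot _ (twistK hK)); exact: adj.
Qed.

End Conjugation.

Lemma star_isomorphic_of_coarse (R : realType) (G L : groupType) (lG : proper_length G)
    (lL : proper_length L) (h : G -> L) (h' : L -> G) :
  cancel h h' -> cancel h' h -> coarse lG lL h -> coarse lL lG h' ->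
  star_isomorphic (reduced_crossed_product R G) (reduced_crossed_product R L).
Proof.
move=> hK h'K hc h'c.
pose Phi := @conjugate R G L h h' hK h'K; pose Psi := @conjugate R L G h' h h'K hK.
have PsiK T : Psi (Phi T) = T.
  apply/funext => u.
  by rewrite -[LHS]/(pull hK (push h'K (T (pull hK (push h'K u))))) !pushK.
have PhiK T : Phi (Psi T) = T.
  apply/funext => u.
  by rewrite -[LHS]/(pull h'K (push hK (T (pull h'K (push hK u))))) !pushK.
exists Phi; split.
- split=> [T|T T' _ _ e|T BT].
  + exact: (conjugate_reduced hK h'K hc).
  + by rewrite -(PsiK T) e PsiK.
  + by exists (Psi T) => //; exact: (conjugate_reduced h'K hK h'c).
- by move=> T1 T2 _ _; apply/funext => u; exact: l2_ext.
- by move=> c T _; apply/funext => u; exact: l2_ext.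
- by move=> T1 T2 _ _; apply/funext => u; rewrite /Phi /conjugate /= pushK.
- by move=> T T' _ _; exact: conjugate_adjoint.
Qed.

Lemma coarse_of_star_isomorphic (R : realType) (G L : groupType) (lG : proper_length G)
    (lL : proper_length L) : countable [set: G] -> countable [set: L] ->
  star_isomorphic (reduced_crossed_product R G) (reduced_crossed_product R L) ->
  exists (h : G -> L) (h' : L -> G),
    [/\ cancel h h', cancel h' h, coarse lG lL h & coarse lL lG h'].
Proof.
move=> cG cL /star_isomorphic_iso[Phi [Psi [iso adj]]].
have [u [wu w'u u0 u0']] := implementing_unitary iso adj.
have iso' := crossed_iso_sym iso.
have cn0 (z : R[i]) : (conjc z != 0) = (z != 0) by rewrite conjc_eq0.
have u0c c : exists a, conjc (u a c) != 0 by have [a] := u0' c; exists a; rewrite cn0.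
have u0c' a : exists c, conjc (u a c) != 0 by have [c] := u0 a; exists c; rewrite cn0.
apply: (coarse_bijection (u := u)) => //.
- exact: implemented_rows iso wu u0.
(* The inverse isomorphism is implemented by the conjugate transpose. *)
- apply: (implemented_rows iso' _ u0c) => c d a b.
  by rewrite conjcK -w'u.
- exact: implemented_approximable iso w'u u0'.
- apply: (implemented_approximable lG iso' _ u0c') => c d a b.
  by rewrite conjcK -wu.
Qed.

Theorem corollary1p3 (R : realType) (G L : groupType)
    (hG : finitely_generated G) (hL : finitely_generated L) :
  (forall (S : genset G) (T : genset L),
     bi_lipschitz_equivalent (word_space R S) (word_space R T))
  <->
  star_isomorphic (reduced_crossed_product R G) (reduced_crossed_product R L).
Proof.
split=> [lip|iso S T].
  (* Finite generation supplies one pair of word metrics, and a single bi-Lipschitz bijection gives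
     the isomorphism. *)
  have [S0 gS] := hG; have [T0 gT] := hL.
  have [f [f' [fK f'K fL f'L]]] := lip (Genset gS) (Genset gT).
  have hK : cancel (fun x : G => ((f (x^-1)%g : L)^-1)%g) (fun y : L => ((f' (y^-1)%g : G)^-1)%g).
    by move=> x; rewrite invgK fK invgK.
  have h'K : cancel (fun y : L => ((f' (y^-1)%g : G)^-1)%g) (fun x : G => ((f (x^-1)%g : L)^-1)%g).
    by move=> x; rewrite invgK f'K invgK.
  exact: (star_isomorphic_of_coarse R hK h'K (coarse_of_lipschitz fL) (coarse_of_lipschitz f'L)).
have [h [h' [hK h'K hc h'c]]] := coarse_of_star_isomorphic (word_proper S) (word_proper T)
  (countable_group S) (countable_group T) iso.
exists (fun x => ((h (x : G)^-1)^-1)%g), (fun y => ((h' (y : L)^-1)^-1)%g); split.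
- by move=> x; rewrite invgK hK invgK.
- by move=> y; rewrite invgK h'K invgK.
- exact: lipschitz_of_coarse.
- exact: lipschitz_of_coarse.
Qed.
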